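(* There is a universal constant $C>0$ such that for every $d\ge1$, every nonempty, compact, centrally symmetric, convex set $T\subset\mathbb{R}^d$ and every $\sigma>0$, $$\max\big\{r(\sigma)^2,\ \mathbb{E}\|\Pi_T(\sigma g)\|_2^2\big\}\le C\,\big(\varepsilon_\star(\sigma)\big)^2 .$$
   Context: $g\sim N(0,I_d)$. $T$ is centrally symmetric if $T=-T$. $w(S)=\mathbb{E}\sup_{x\in S}\langle x,g\rangle$ is the Gaussian width, $B_2^d$ the closed Euclidean unit ball, and $r(\sigma)=\operatorname*{arg\,max}_{r\ge0}\{w(T\cap rB_2^d)-r^2/(2\sigma)\}$ (which exists and is unique). $\Pi_T(x)=\operatorname*{arg\,min}_{t\in T}\|x-t\|_2^2$ is the Euclidean projection. The minimax rate is $$\big(\varepsilon_\star(\sigma)\big)^2=\inf_{\hat\theta}\sup_{\theta\in T}\mathbb{E}_{Y\sim N(\theta,\sigma^2I_d)}\big[\|\hat\theta(Y)-\theta\|_2^2\big],$$ the infimum being over all measurable functions $\hat\theta:\mathbb{R}^d\to\mathbb{R}^d$; $\varepsilon_\star(\sigma)\ge0$. *)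

(* Defs.v *)
From HB Require Import structures.
From mathcomp Require Import all_boot all_order all_algebra.
From mathcomp Require Import all_classical all_reals all_analysis.

Set Implicit Arguments.
Unset Strict Implicit.
Unset Printing Implicit Defensive.
Import Order.TTheory GRing.Theory Num.Theory.
Import numFieldNormedType.Exports.
Local Open Scope classical_set_scope.
Local Open Scope ring_scope.

(* The library norm `|x| on 'rV[R]_d is the sup norm (with the same topology),
   hence the explicit Euclidean structure. *)
Definition dotprod (R : realType) (d : nat) (x y : 'rV[R]_d) : R :=
  \sum_(i < d) x 0 i * y 0 i.

Definition l2norm (R : realType) (d : nat) (x : 'rV[R]_d) : R :=
  Num.sqrt (dotprod x x).

Definition l2ball (R : realType) (d : nat) (r : R) : set 'rV[R]_d :=
  [set x | l2norm x <= r].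

(* R^d with its Borel sigma-algebra; convertible to 'rV[R]_d. *)
Definition borelRV (R : realType) (d : nat) :=
  g_sigma_algebraType (@open 'rV[R]_d).

HB.instance Definition _ (R : realType) (d : nat) :=
  Measurable.on (borelRV R d).

Section product_law.
Variable R : realType.

Definition tuple_consX (n : nat) 
    (x : measurableTypeR R * n.-tuple (measurableTypeR R)) :
    n.+1.-tuple (measurableTypeR R) :=
  [tuple of x.1 :: x.2].

Lemma measurable_tuple_consX (n : nat) :
  measurable_fun [set: measurableTypeR R * n.-tuple (measurableTypeR R)] (@tuple_consX n).
Proof. exact: measurable_cons. Qed.

HB.instance Definition _ (n : nat) :=
  isMeasurableFun.Build _ _ _ _ (@tuple_consX n) (@measurable_tuple_consX n).

(* The product probability P 0 \x ... \x P n.-1. *)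
Fixpoint product_law (n : nat) :
    ('I_n -> probability (measurableTypeR R) R) ->
    probability (n.-tuple (measurableTypeR R)) R :=
  match n with
  | 0 => fun=> dirac [tuple]
  | m.+1 => fun P =>
      distribution (P ord0 \x product_law (fun i : 'I_m => P (lift ord0 i)))%E
        (@tuple_consX m)
  end.

Definition row_of_tuple (n : nat) (t : n.-tuple (measurableTypeR R)) :
    borelRV R n :=
  \row_(i < n) tnth t i.

Lemma measurable_row_of_tuple (n : nat) :
  measurable_fun [set: n.-tuple (measurableTypeR R)] (@row_of_tuple n).
Proof.
apply: measurability; first by [].
move=> _ [U oU <-]; rewrite setTI.
pose box (p : 'rV[rat]_n * 'rV[rat]_n) :=
  [set x : 'rV[R]_n | forall i, ratr (p.1 0 i) < x 0 i < ratr (p.2 0 i)].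
have -> : U = \bigcup_(p in [set p | box p `<=` U]) box p.
  apply/seteqP; split=> [x Ux|x [p pU]]; last exact: pU.
  have /nbhs_ballP[e /= e0 eU] : nbhs x U by exact: open_nbhs_nbhs.
  have lo i : {q | x 0 i - e < ratr q < x 0 i}.
    apply: cid; have /rat_in_itvoo[q] : x 0 i - e < x 0 i by rewrite gtrBl.
    by rewrite in_itv/=; exists q.
  have hi i : {q | x 0 i < ratr q < x 0 i + e}.
    apply: cid; have /rat_in_itvoo[q] : x 0 i < x 0 i + e by rewrite ltrDl.
    by rewrite in_itv/=; exists q.
  exists (\row_i sval (lo i), \row_i sval (hi i)) => [y yb|i] /=; last first.
    rewrite !mxE; case: (lo i) => /= p /andP[_ ->].
    by case: (hi i) => /= q /andP[-> _].
  apply: eU; split=> // i j; rewrite (ord1 i) /ball/=.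
  have := yb j; rewrite /= !mxE; case: (lo j) => /= p /andP[xp _].
  case: (hi j) => /= q /andP[_ qx] /andP[py yq].
  rewrite ltr_distlC; apply/andP; split; first exact: lt_trans py.
  exact: lt_trans qx.
rewrite preimage_bigcup bigcup_mkcond.
apply: countable_bigcupT_measurable => // p; case: ifPn => // _.
rewrite (_ : _ @^-1` _ = \bigcap_(i in [set: 'I_n])
    (@tnth n R ^~ i) @^-1` `]ratr (p.1 0 i), ratr (p.2 0 i)[%classic); last first.
  apply/seteqP; split=> t /= tb i; last first.
    by have := tb i Logic.I; rewrite /= in_itv/= mxE.
  by move=> _; have := tb i; rewrite /= in_itv/= mxE.
apply: fin_bigcap_measurable => // i _; rewrite -[X in measurable X]setTI.
exact: measurable_tnth.
Qed.

HB.instance Definition _ (n : nat) :=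
  isMeasurableFun.Build _ _ _ _ (@row_of_tuple n) (@measurable_row_of_tuple n).

End product_law.

(* The law N(theta, sigma^2 I_d); [normal_prob m s] has mean m and standard
   deviation s. *)
Definition gaussian (R : realType) (d : nat) (theta : 'rV[R]_d) (sigma : R) :
    probability (borelRV R d) R :=
  distribution (product_law (fun i => normal_prob (theta 0 i) sigma))
    (@row_of_tuple R d).

Definition gaussian_width (R : realType) (d : nat) (S : set 'rV[R]_d) : \bar R :=
  (\int[gaussian (0 : 'rV[R]_d) 1]_g
     ereal_sup [set (dotprod x g)%:E | x in S])%E.

(* arg max and arg min are rendered with [xget 0 A], an element of A if A is
   nonempty; for compact convex symmetric T the maximizer (resp. the nearest
   point) exists and is unique, so the default 0 plays no role. *)
Definition critical_radius (R : realType) (d : nat) (T : set 'rV[R]_d)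
    (sigma : R) : R :=
  let phi (r : R) := (gaussian_width (T `&` l2ball r) - (r ^+ 2 / (2 * sigma))%:E)%E
  in xget 0 [set r : R | 0 <= r /\
    forall s : R, 0 <= s -> (phi s <= phi r)%E].

Definition euclidean_proj (R : realType) (d : nat) (T : set 'rV[R]_d) (x : 'rV[R]_d) :
    'rV[R]_d :=
  xget 0 [set t | T t /\
    forall s, T s -> l2norm (x - t) ^+ 2 <= l2norm (x - s) ^+ 2].

(* The minimax rate epsilon_star(sigma), whose square is the minimax risk. *)
Definition minimax_rate (R : realType) (d : nat) (T : set 'rV[R]_d)
    (sigma : R) : \bar R :=
  sqrte (ereal_inf
    [set ereal_sup
           [set (\int[gaussian theta sigma]_y
                   (l2norm (est y - theta) ^+ 2)%:E)%E | theta in T]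
    | est in [set f : borelRV R d -> borelRV R d | measurable_fun setT f]]).

(* Main.v *)
(** The Gaussian width f(s) of T ∩ sB gains at least a multiple of r^2/sigma
    between r/4 and r at the critical radius r = r(sigma), by maximality
    against r/4.  Cover T ∩ rB by N balls of radius r/4.  Each piece has width
    at most f(r/4), because averaging it with the reflection of a copy of
    itself lands in T ∩ (r/4)B (this is where convexity and central symmetry
    enter), so Gaussian concentration gives
    f(r) - f(r/4) <= log N / b + b r^2 for every b > 0, which forces log N to
    be of order r^2/sigma^2.  Hence T ∩ rB contains an (r/4)-separated set that
    large; after shrinking it by a constant factor, a Cauchy-Schwarz testing
    argument bounds the risk of any estimator below by a multiple of r^2.

    For the projection, rho = |Pi_T(sigma g)| satisfies
    rho <= 4 s + (2 sigma / 3 s) (W_(4s) - W_s) pointwise, W_s being the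
    support function of T ∩ sB at g.  For s just above the minimax rate the
    previous argument bounds f(4s) - f(s) by a multiple of s^2/sigma, and
    concentration bounds the fluctuations.

    Gaussian concentration comes from the inequality E u * E v <= 1 whenever
    u(x) v(y) <= exp(|x - y|^2/4), an instance of Prekopa-Leindler that
    tensorizes, so that only its one-dimensional case needs a proof. *)
Require Import Defs.
From HB Require Import structures.
From mathcomp Require Import all_boot all_order all_algebra.
From mathcomp Require Import all_classical all_reals all_analysis.
From mathcomp Require Import measurable_realfun ring lra.
Import Order.TTheory GRing.Theory Num.Theory.
Import numFieldNormedType.Exports.
Local Open Scope classical_set_scope.
Local Open Scope ring_scope.

Set Implicit Arguments.
Unset Strict Implicit.
Unset Printing Implicit Defensive.

(** * Integration against the normal law *)

Section density.
Local Open Scope ereal_scope.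
Context d (T : measurableType d) (R : realType).
Variables (mu nu : {measure set T -> \bar R}) (p : T -> R).
Hypothesis p0 : forall x, (0 <= p x)%R.
Hypothesis mp : measurable_fun setT p.
Hypothesis nuE : forall A, measurable A -> nu A = \int[mu]_(x in A) (p x)%:E.

Import HBNNSimple.

Let integral_density_nnsfun (f : {nnsfun T >-> R}) :
  \int[nu]_x (f x)%:E = \int[mu]_x ((f x)%:E * (p x)%:E).
Proof.
under [LHS]eq_integral do rewrite fimfunE -fsumEFin//.
rewrite [LHS]ge0_integral_fsum//; last 2 first.
  - by move=> r; exact/measurable_EFinP/measurableT_comp.
  - by move=> n x _; rewrite EFinM nnfun_muleindic_ge0.
under [RHS]eq_integral.
  move=> x xD; rewrite fimfunE -fsumEFin// muleC ge0_mule_fsumr; last first.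
    by move=> r; rewrite EFinM nnfun_muleindic_ge0.
  over.
rewrite [RHS]ge0_integral_fsum//; last 2 first.
  - move=> r; apply: emeasurable_funM; first exact/measurable_EFinP.
    exact/measurable_EFinP/measurableT_comp.
  - move=> n x _; rewrite EFinM mule_ge0//; first by rewrite lee_fin.
    by rewrite nnfun_muleindic_ge0.
apply: eq_fsbigr => r; rewrite inE/= => -[t _ rt].
have r0 : (0 <= r)%R by rewrite -rt.
under eq_integral do rewrite EFinM.
rewrite ge0_integralZl//; last exact/measurable_EFinP/measurable_indic.
rewrite integral_indic// setIT nuE//.
under [RHS]eq_integral do rewrite EFinM muleCA.
rewrite ge0_integralZl//; last 2 first.
- apply: emeasurable_funM; first exact/measurable_EFinP.
  exact/measurable_EFinP/measurable_indic.
- by move=> x _; rewrite mule_ge0// lee_fin.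
congr (_ * _); rewrite integral_mkcond; apply: eq_integral => x _.
by rewrite patchE indicE; case: ifP => _; rewrite ?mule1 ?mule0.
Qed.

(** On simple functions the claim is [nuE] summed over the level sets; monotone convergence along
    [nnsfun_approx] does the rest. *)
Lemma ge0_integral_density (f : T -> \bar R) :
  measurable_fun setT f -> (forall x, 0 <= f x) ->
  \int[nu]_x f x = \int[mu]_x (f x * (p x)%:E).
Proof.
move=> mf f0.
pose f_ := nnsfun_approx measurableT mf.
have nd n m x : (n <= m)%N -> ((f_ n x)%:E <= (f_ m x)%:E).
  by move=> nm; rewrite lee_fin; exact/lefP/nd_nnsfun_approx.
transitivity (lim (\int[nu]_x (f_ n x)%:E @[n --> \oo])).
  rewrite -monotone_convergence//=.
  - apply: eq_integral => ? /[!inE] xD; apply/esym/cvg_lim => //=.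
    exact: cvg_nnsfun_approx.
  - by move=> n; exact/measurable_EFinP/measurable_funTS.
  - by move=> n ? _; rewrite lee_fin.
  - by move=> ? _ ? ? mn; exact: nd.
transitivity (lim (\int[mu]_x ((f_ n x)%:E * (p x)%:E) @[n --> \oo])).
  by apply: congr_lim; apply/funext => n /=; exact: integral_density_nnsfun.
rewrite -monotone_convergence//=.
- apply: eq_integral => x _; apply/cvg_lim => //=.
  under eq_fun do rewrite muleC.
  rewrite muleC; apply: cvgeZl => //.
  exact: cvg_nnsfun_approx.
- move=> n; apply: emeasurable_funM; exact/measurable_EFinP/measurable_funTS.
- by move=> n ? _; rewrite mule_ge0// lee_fin.
- by move=> x _ ? ? mn; rewrite lee_wpmul2r ?lee_fin// -lee_fin; exact: nd.
Qed.

End density.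

Lemma ge0_integral_normal_prob (R : realType) (m s : R) (f : R -> \bar R) :
  measurable_fun setT f -> (forall x, 0 <= f x)%E ->
  (\int[normal_prob m s]_x f x =
   \int[lebesgue_measure]_x (f x * (normal_pdf m s x)%:E))%E.
Proof.
move=> mf f0; apply: ge0_integral_density => //.
- exact: normal_pdf_ge0.
- exact: measurable_normal_pdf.
Qed.

(** * The one-dimensional Prekopa-Leindler inequality *)

(** Each set lies between its infimum and its supremum, so its measure is at most its diameter; the
    hypothesis bounds the sum of the two diameters. *)
Lemma lebesgue_measure_le_diameters (R : realType) (A B : set R) (L : R) :
  measurable A -> measurable B -> A !=set0 -> B !=set0 ->
  (forall x x' y y', A x -> A x' -> B y -> B y' -> (x' - x) + (y' - y) <= L) ->
  (lebesgue_measure A + lebesgue_measure B <= L%:E)%E.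
Proof.
move=> mA mB [a Aa] [b Bb] ABL.
have encl (D : set R) : measurable D -> D !=set0 -> has_sup D -> has_inf D ->
    (lebesgue_measure D <= (sup D - inf D)%:E)%E.
  move=> mD [z Dz] [_ ubD] [_ lbD].
  rewrite (@le_trans _ _ (lebesgue_measure `[inf D, sup D]%classic))//.
    apply: le_measure; rewrite ?inE// => y Dy /=.
    by rewrite in_itv/= ge_inf ?ub_le_sup.
  rewrite lebesgue_measure_itv/= lte_fin; case: ltP => //.
  by rewrite lee_fin subr_ge0 (le_trans (ge_inf lbD Dz))// ub_le_sup.
have sA : has_sup A.
  split; first by exists a.
  by exists (L + a) => x Ax; have := ABL _ _ _ _ Aa Ax Bb Bb; lra.
have iA : has_inf A.
  split; first by exists a.
  by exists (a - L) => x Ax; have := ABL _ _ _ _ Ax Aa Bb Bb; lra.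
have sB : has_sup B.
  split; first by exists b.
  by exists (L + b) => x Bx; have := ABL _ _ _ _ Aa Aa Bb Bx; lra.
have iB : has_inf B.
  split; first by exists b.
  by exists (b - L) => x Bx; have := ABL _ _ _ _ Aa Aa Bx Bb; lra.
have A0 : A !=set0 by exists a.
have B0 : B !=set0 by exists b.
apply: (le_trans (leeD (encl A mA A0 sA iA) (encl B mB B0 sB iB))).
rewrite -EFinD lee_fin.
(* The two suprema and the two infima are removed one at a time, each by its universal property. *)
suff : sup A <= L + inf A - (sup B - inf B) by lra.
apply: ge_sup => // x Ax.
suff : x - L + (sup B - inf B) <= inf A by lra.
apply: lb_le_inf => // x' Ax'.
suff : sup B <= L + inf B - (x - x') by lra.
apply: ge_sup => // y By.
suff : y - L + (x - x') <= inf B by lra.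
by apply: lb_le_inf => // y' By'; have := ABL _ _ _ _ Ax' Ax By' By; lra.
Qed.

Section layer_cake.
Context (R : realType).
Local Notation mu := (@lebesgue_measure R).

(** Requiring [0 <= t] empties the levels of negative height, so that layer-cake integrals run over
    all of [R]. *)
Let level (f : R -> R) (t : R) : set R := [set x | 0 <= t < f x].

Let level_set2 (f : R -> R) : set (R * R) := [set p | 0 <= p.2 < f p.1].

Let measurable_level_set2 (f : R -> R) : measurable_fun setT f ->
  measurable (level_set2 f).
Proof.
move=> mf; rewrite (_ : level_set2 f =
    (fun p : R * R => 0 <= p.2) @^-1` [set true] `&`
    (fun p : R * R => p.2 < f p.1) @^-1` [set true]); last first.
  by apply/seteqP; split=> p; rewrite /level_set2/= => /andP.
apply: measurableI.
- have /(_ measurableT [set true]) : measurable_fun setT (fun p : R * R => 0 <= p.2).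
    by apply: measurable_fun_ler.
  by rewrite setTI; exact.
- have /(_ measurableT [set true]) :
      measurable_fun setT (fun p : R * R => p.2 < f p.1).
    by apply: measurable_fun_ltr => //; exact: measurableT_comp.
  by rewrite setTI; exact.
Qed.

Lemma measurable_level (f : R -> R) t : measurable_fun setT f -> measurable (level f t).
Proof.
move=> mf; have [t0|t0] := leP 0 t; last first.
  rewrite (_ : level f t = set0)//; apply/seteqP; split=> x //=.
  by rewrite /level/= leNgt t0.
have /(_ measurableT [set true]) : measurable_fun setT (fun x : R => t < f x).
  exact: measurable_fun_ltr.
rewrite setTI (_ : _ @^-1` _ = level f t); first exact.
by apply/seteqP; split=> x; rewrite /level/= t0.
Qed.

(** Tonelli for the indicator of the region under the graph: its sections are the levels in one
    direction and [0, f x) in the other. *)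
Lemma layer_cake (f : R -> R) : measurable_fun setT f -> (forall x, 0 <= f x) ->
  measurable_fun setT (fun t => mu (level f t)) /\
  (\int[mu]_x (f x)%:E = \int[mu]_t mu (level f t))%E.
Proof.
move=> mf f0.
pose h (p : R * R) : \bar R := (\1_(level_set2 f) p)%:E.
have mh : measurable_fun setT h.
  by apply/measurable_EFinP; apply: measurable_indic; exact: measurable_level_set2.
have h0 p : (0 <= h p)%E by rewrite lee_fin.
have levelE : (fun t => mu (level f t)) = fubini_G mu h.
  apply/funext => t; rewrite /fubini_G/=.
  rewrite -[level f t]setIT -integral_indic//; last exact: measurable_level.
split.
  rewrite levelE; exact: measurable_fun_fubini_tonelli_G.
under [RHS]eq_integral do rewrite -/((fun t => mu (level f t)) _).
rewrite levelE -fubini_tonelli2// fubini_tonelli1//.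
apply: eq_integral => x _; rewrite /fubini_F.
transitivity (\int[mu]_y (\1_(`[0, f x[%classic) y)%:E)%E.
  rewrite integral_indic// setIT/= lebesgue_measure_itv/= lte_fin sube0.
  by case: ltgtP (f0 x) => // <-.
apply: eq_integral => y _; rewrite /h !indicE; congr ((nat_of_bool _)%:R%:E).
Qed.

(* Prekopa-Leindler for functions with the same supremum [k], where it is
   elementary: two level sets of equal height below [k] are nonempty and their
   midpoints lie in a level set of the density, which is an interval. *)
Lemma integral_le_of_mid_le (f g : R -> R) (k : R) :
  measurable_fun setT f -> measurable_fun setT g ->
  (forall x, 0 <= f x <= k) -> (forall x, 0 <= g x <= k) ->
  (forall t, t < k -> exists x, t < f x) ->
  (forall t, t < k -> exists x, t < g x) ->
  (forall x y, f x * g y <= normal_pdf 0 1 ((x + y) / 2) ^+ 2) ->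
  (\int[mu]_x (f x)%:E + \int[mu]_x (g x)%:E <= 2%:E)%E.
Proof.
move=> mf mg fk gk supf supg fg.
pose p : R -> R := normal_pdf 0 1.
have mp : measurable_fun setT p by exact: measurable_normal_pdf.
have p0 x : 0 <= p x by exact: normal_pdf_ge0.
have f0 x : 0 <= f x by case/andP: (fk x).
have g0 x : 0 <= g x by case/andP: (gk x).
have [mLf ->] := layer_cake mf f0; have [mLg ->] := layer_cake mg g0.
have [mLp Lp] := layer_cake mp p0.
rewrite -ge0_integralD//.
(* As [p] has mass 1, it suffices to bound, at each height, the two levels of [f] and [g] by twice
   that of [p]. *)
apply: (@le_trans _ _ (\int[mu]_t (2%:E * mu (level p t)))%E); last first.
  by rewrite ge0_integralZl// -Lp /p integral_normal_pdf mule1.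
apply: ge0_le_integral => //.
- by move=> x _; rewrite adde_ge0.
- exact: emeasurable_funD.
- exact: emeasurable_funM.
move=> t _; have [t0|t0] := ltP t 0.
  have e0 h : level h t = set0.
    by apply/seteqP; split=> x //=; rewrite /level/= leNgt t0.
  by rewrite !e0 measure0 mule0 adde0.
have [kt|tk] := leP k t.
  have e0 h : (forall x, 0 <= h x <= k) -> level h t = set0.
    move=> hk; apply/seteqP; split=> x //=; rewrite /level/= t0/=.
    by case/andP: (hk x) => _ hx /lt_le_trans/(_ hx)/lt_le_trans/(_ kt); rewrite ltxx.
  by rewrite (e0 f)// (e0 g)// measure0 adde0 mule_ge0.
have plevel x y : level f t x -> level g t y -> level p t ((x + y) / 2).
  rewrite /level/= t0/= => tf tg.
  rewrite -(@ltr_pXn2r _ 2)// ?nnegrE ?p0//.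
  by apply: lt_le_trans (fg _ _); rewrite expr2 ltr_pM.
(* A point between [x] and [y] is no farther from 0 than one of them, and [p] decreases with the
   distance to 0. *)
have pitv x y : level p t x -> level p t y -> `[x, y]%classic `<=` level p t.
  rewrite /level/= t0/= => tx ty z /=; rewrite in_itv/= => /andP[xz zy].
  have [xy|xy] : x ^+ 2 >= z ^+ 2 \/ y ^+ 2 >= z ^+ 2.
  - by have [z0|z0] := leP 0 z; [right|left]; nra.
  - apply: (lt_le_trans tx); rewrite /p !normal_pdfE ?oner_neq0//.
    rewrite ler_wpM2l ?normal_peak_ge0// ler_expR !subr0 ler_wpM2r//.
    by rewrite lerN2.
  - apply: (lt_le_trans ty); rewrite /p !normal_pdfE ?oner_neq0//.
    rewrite ler_wpM2l ?normal_peak_ge0// ler_expR !subr0 ler_wpM2r//.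
    by rewrite lerN2.
have mlp : measurable (level p t) by exact: measurable_level.
have pdiam x y : level p t x -> level p t y -> ((y - x)%:E <= mu (level p t))%E.
  move=> px py; have [xy|xy] := leP x y; last first.
    by rewrite (le_trans _ (measure_ge0 _ _))// lee_fin subr_le0 ltW.
  apply: (@le_trans _ _ (mu `[x, y]%classic)).
    rewrite lebesgue_measure_itv/= lte_fin; case: ltP => // yx.
    by rewrite lee_fin subr_le0.
  by apply: le_measure; rewrite ?inE//; exact: pitv.
have : (0 <= mu (level p t))%E by exact: measure_ge0.
case E : (mu (level p t)) => [l| |] l0; [|by rewrite gt0_muley ?leey|
  by move: l0; rewrite leeNy_eq].
rewrite -EFinM; apply: lebesgue_measure_le_diameters.
- exact: measurable_level.
- exact: measurable_level.
- by have [x tx] := supf _ tk; exists x; rewrite /level/= t0.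
- by have [x tx] := supg _ tk; exists x; rewrite /level/= t0.
move=> x x' y y' fx fx' gy gy'.
have := pdiam _ _ (plevel _ _ fx gy) (plevel _ _ fx' gy').
by rewrite E lee_fin; lra.
Qed.

End layer_cake.

Section gaussian_prekopa_leindler1.
Context (R : realType).
Local Notation mu := (@lebesgue_measure R).

(** Parallelogram identity in the exponents; it turns the cost |x - y|^2/4 into the midpoint
    condition of [integral_le_of_mid_le]. *)
Lemma normal_pdf_mid (x y : R) :
  expR ((x - y) ^+ 2 / 4) * (normal_pdf 0 1 x * normal_pdf 0 1 y) =
  normal_pdf 0 1 ((x + y) / 2) ^+ 2.
Proof.
rewrite !normal_pdfE ?oner_neq0// /normal_fun exprMn -expRM_natl.
rewrite [X in _ * X = _]mulrACA [LHS]mulrCA -!expRD -expr2.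
by congr (_ * expR _); field.
Qed.

(** Weighted by the density, [u] and [v] are rescaled to a common supremum by factors of product 1;
    the additive bound for equal suprema then yields the product bound. *)
Let pl1_real (u v : R -> R) :
  measurable_fun setT u -> measurable_fun setT v ->
  (forall x, 0 <= u x) -> (forall x, 0 <= v x) ->
  (forall x y, u x * v y <= expR ((x - y) ^+ 2 / 4)) ->
  ((\int[normal_prob 0 1]_x (u x)%:E) * (\int[normal_prob 0 1]_x (v x)%:E)
     <= 1)%E.
Proof.
move=> mu_ mv u0 v0 uv.
have [/existsNP[x0 ux0]|uE] := pselect (~ (forall x, u x = 0)); last first.
  have {}uE : forall x, u x = 0 by apply: contrapT.
  by rewrite integral0_eq ?mul0e// => x _; rewrite uE.
have [/existsNP[y0 vy0]|vE] := pselect (~ (forall x, v x = 0)); last first.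
  have {}vE : forall x, v x = 0 by apply: contrapT.
  by rewrite [X in (_ * X)%E]integral0_eq ?mule0// => x _; rewrite vE.
rewrite !ge0_integral_normal_prob//; [|exact/measurable_EFinP..].
pose p : R -> R := normal_pdf 0 1.
have mp : measurable_fun setT p by exact: measurable_normal_pdf.
have p0 x : 0 < p x.
  by rewrite /p normal_pdfE ?oner_neq0// mulr_gt0 ?expR_gt0// normal_peak_gt0 ?oner_neq0.
pose f x := u x * p x; pose g x := v x * p x.
have mf : measurable_fun setT f by exact: measurable_funM.
have mg : measurable_fun setT g by exact: measurable_funM.
have f0 x : 0 <= f x by rewrite mulr_ge0// ltW.
have g0 x : 0 <= g x by rewrite mulr_ge0// ltW.
have fg x y : f x * g y <= p ((x + y) / 2) ^+ 2.
  by rewrite -normal_pdf_mid mulrACA ler_wpM2r// mulr_ge0// ltW.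
have fx0 : 0 < f x0 by rewrite mulr_gt0// lt_neqAle eq_sym u0 andbT; exact/eqP.
have gy0 : 0 < g y0 by rewrite mulr_gt0// lt_neqAle eq_sym v0 andbT; exact/eqP.
have pub x : p x <= normal_peak 1 by exact: normal_pdf_ub (oner_neq0 _).
(* A positive value of either function bounds the other from above, so both suprema are finite. *)
have fgub x y : f x * g y <= normal_peak 1 ^+ 2.
  by rewrite (le_trans (fg x y))// lerXn2r ?nnegrE ?normal_peak_ge0// ltW.
have sf : has_sup (range f).
  split; first by exists (f x0), x0.
  by exists (normal_peak 1 ^+ 2 / g y0) => _ [x _ <-]; rewrite ler_pdivlMr.
have sg : has_sup (range g).
  split; first by exists (g y0), y0.
  by exists (normal_peak 1 ^+ 2 / f x0) => _ [x _ <-]; rewrite ler_pdivlMr// mulrC.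
pose A := sup (range f); pose B := sup (range g).
have fA x : f x <= A by apply: ub_le_sup; [case: sf|exists x].
have gB x : g x <= B by apply: ub_le_sup; [case: sg|exists x].
have A0 : 0 < A by exact: lt_le_trans (fA x0).
have B0 : 0 < B by exact: lt_le_trans (gB y0).
(* The factors [k / A] and [k / B] bring both suprema to [k], and their product is 1. *)
pose k := Num.sqrt (A * B).
have k0 : 0 < k by rewrite sqrtr_gt0 mulr_gt0.
have k2 : k ^+ 2 = A * B by rewrite sqr_sqrtr// mulr_ge0// ltW.
have kA : 0 < k / A by rewrite divr_gt0.
have kB : 0 < k / B by rewrite divr_gt0.
have : (\int[mu]_x (k / A * f x)%:E + \int[mu]_x (k / B * g x)%:E <= 2%:E)%E.
  apply: (@integral_le_of_mid_le _ _ _ k).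
  - exact: measurable_funM.
  - exact: measurable_funM.
  - move=> x; rewrite mulr_ge0 ?(ltW kA)//=.
    by rewrite mulrAC ler_pdivrMr// ler_pM2l.
  - move=> x; rewrite mulr_ge0 ?(ltW kB)//=.
    by rewrite mulrAC ler_pdivrMr// ler_pM2l.
  - move=> t tk; have [||_ [x _ <-] tx] := @sup_gt _ (range f) (t / (k / A)).
    + by exists (f x0), x0.
    + by rewrite ltr_pdivrMr// mulrCA mulfV ?gt_eqF// mulr1.
    by exists x; rewrite mulrC -ltr_pdivrMr.
  - move=> t tk; have [||_ [x _ <-] tx] := @sup_gt _ (range g) (t / (k / B)).
    + by exists (g y0), y0.
    + by rewrite ltr_pdivrMr// mulrCA mulfV ?gt_eqF// mulr1.
    by exists x; rewrite mulrC -ltr_pdivrMr.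
  - move=> x y; apply: le_trans (fg x y).
    rewrite mulrACA (_ : k / A * (k / B) = 1) ?mul1r//.
    by rewrite mulrACA -invfM -k2 -expr2 mulfV// gt_eqF// exprn_gt0.
have Z (h : R -> R) (c : R) : measurable_fun setT h -> (forall x, 0 <= h x) -> 0 < c ->
   (\int[mu]_x (c * h x)%:E = c%:E * \int[mu]_x (h x)%:E)%E.
  move=> mh h0 c0; under eq_integral do rewrite EFinM.
  rewrite ge0_integralZl//; [exact/measurable_EFinP|
    by move=> x _; rewrite lee_fin|by rewrite lee_fin ltW].
rewrite !Z//.
have fE : (\int[mu]_x ((u x)%:E * (p x)%:E) = \int[mu]_x (f x)%:E)%E.
  by apply: eq_integral => x _; rewrite EFinM.
have gE : (\int[mu]_x ((v x)%:E * (p x)%:E) = \int[mu]_x (g x)%:E)%E.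
  by apply: eq_integral => x _; rewrite EFinM.
rewrite fE gE.
have : (0 <= \int[mu]_x (f x)%:E)%E by apply: integral_ge0 => x _; rewrite lee_fin.
have : (0 <= \int[mu]_x (g x)%:E)%E by apply: integral_ge0 => x _; rewrite lee_fin.
have kAy : ((k / A)%:E * +oo = +oo)%E by rewrite gt0_muley ?lte_fin.
have kBy : ((k / B)%:E * +oo = +oo)%E by rewrite gt0_muley ?lte_fin.
case: (\int[mu]_x (f x)%:E)%E => [a| |//]; case: (\int[mu]_x (g x)%:E)%E => [b| |//];
  rewrite ?kAy ?kBy// ?addey ?addye//.
rewrite !lee_fin => b0 a0 ab.
have kk : k / A * (k / B) = 1.
  by rewrite mulrACA -invfM -k2 -expr2 mulfV// gt_eqF// exprn_gt0.
move: kk ab; set c := k / A; set e := k / B => kk ab.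
rewrite (_ : a * b = (c * a) * (e * b)); last by rewrite mulrACA kk mul1r.
have ca : 0 <= c * a by rewrite mulr_ge0// ltW.
have eb : 0 <= e * b by rewrite mulr_ge0// ltW.
have {}ab : c * a + e * b <= 2 := ab.
(* Arithmetic-geometric mean inequality: a sum at most 2 forces a product at most 1. *)
move: ca eb ab; set s := c * a; set t := e * b => s0 t0 st.
by have := sqr_ge0 (s - t); nra.
Qed.

Lemma gaussian_prekopa_leindler1 (u v : R -> \bar R) :
  measurable_fun setT u -> measurable_fun setT v ->
  (forall x, 0 <= u x)%E -> (forall x, 0 <= v x)%E ->
  (forall x y, u x * v y <= (expR ((x - y) ^+ 2 / 4))%:E)%E ->
  ((\int[normal_prob 0 1]_x u x) * (\int[normal_prob 0 1]_x v x) <= 1)%E.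
Proof.
move=> mu_ mv u0 v0 uv.
have [[x ux]|/forallNP uoo] := pselect (exists x, u x = +oo%E).
  rewrite [X in (_ * X)%E]integral0_eq ?mule0// => y _; apply/eqP.
  apply: contraT => vy; have := uv x y.
  by rewrite ux gt0_mulye// lt_neqAle eq_sym vy v0.
have [[y vy]|/forallNP voo] := pselect (exists x, v x = +oo%E).
  rewrite integral0_eq ?mul0e// => x _; apply/eqP.
  apply: contraT => ux; have := uv x y.
  by rewrite vy gt0_muley// lt_neqAle eq_sym ux u0.
have uE x : u x = (fine (u x))%:E.
  by rewrite fineK// ge0_fin_numE// ltey; exact/eqP.
have vE x : v x = (fine (v x))%:E.
  by rewrite fineK// ge0_fin_numE// ltey; exact/eqP.
under eq_integral do rewrite uE; under [X in (_ * X)%E]eq_integral do rewrite vE.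
apply: pl1_real.
- exact: measurableT_comp.
- exact: measurableT_comp.
- by move=> x; rewrite fine_ge0.
- by move=> x; rewrite fine_ge0.
- by move=> x y; rewrite -lee_fin EFinM -uE -vE.
Qed.

End gaussian_prekopa_leindler1.

(** * Product measures *)

Section product_law_theory.
Context (R : realType).
Local Notation mR := (measurableTypeR R).
Local Open Scope ereal_scope.

Lemma measurable_tuple_cons n (h : n.+1.-tuple mR -> \bar R) :
  measurable_fun setT h ->
  measurable_fun setT (fun p : mR * n.-tuple mR => h (tuple_consX p)).
Proof.
move=> mh; apply: (measurableT_comp mh); exact: measurable_tuple_consX.
Qed.

Lemma measurable_tuple_cons_snd n (h : n.+1.-tuple mR -> \bar R) (x : R) :
  measurable_fun setT h ->
  measurable_fun setT (fun t : n.-tuple mR => h [tuple of x :: t]).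
Proof.
move=> mh; apply: (measurableT_comp mh).
by apply: measurable_cons => //; exact: measurable_id.
Qed.

Section recursion.
Variables (n : nat) (P : 'I_n.+1 -> probability mR R).
Variable h : n.+1.-tuple mR -> \bar R.
Hypotheses (mh : measurable_fun setT h) (h0 : forall t, 0 <= h t).
Let P' i := P (lift ord0 i).

Lemma ge0_integral_product_lawS :
  \int[product_law P]_t h t =
  \int[P ord0]_x \int[product_law P']_t h [tuple of x :: t].
Proof.
rewrite /= ge0_integral_distribution// fubini_tonelli1//.
- exact: measurable_tuple_cons.
- by move=> p /=.
Qed.

Lemma measurable_integral_tuple_cons :
  measurable_fun setT (fun x => \int[product_law P']_t h [tuple of x :: t]).
Proof.
apply: (@measurable_fun_fubini_tonelli_F _ _ _ _ _ (product_law P')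
  (fun p => h (tuple_consX p))) => //.
exact: measurable_tuple_cons.
Qed.

End recursion.

Lemma integral_product_law0 (P : 'I_0 -> probability mR R)
    (h : 0.-tuple mR -> \bar R) : measurable_fun setT h ->
  \int[product_law P]_t h t = h [tuple].
Proof. by move=> mh; rewrite integral_dirac// diracT mul1e. Qed.

Lemma lebesgue_measure_oppr (A : set R) : measurable A ->
  lebesgue_measure ((-%R : R -> R) @^-1` A) = lebesgue_measure A.
Proof.
move=> mA; apply/esym.
have mo : measurable_fun setT (-%R : mR -> mR) by exact: oppr_measurable.
apply: (@lebesgue_measure_unique R (pushforward lebesgue_measure (-%R : mR -> mR)))
  => // X [[a b] /= ab <-].
(* Reflection moves the closed end of the half-open interval to the other side and keeps the
   length. *)
rewrite /pushforward (_ : _ @^-1` _ = `[(- b)%R, (- a)%R[%classic); last first.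
  apply/seteqP; split => x /=; rewrite !in_itv/= => /andP[ax xb];
    by apply/andP; split; lra.
rewrite !lebesgue_measure_itv/= !lte_fin ltrN2; case: ifP => // _.
by rewrite -!EFinB; congr EFin; lra.
Qed.

Lemma ge0_integral_normal_prob_oppr (f : mR -> \bar R) :
  measurable_fun setT f -> (forall x, 0 <= f x) ->
  \int[normal_prob 0 1]_x f (- x)%R = \int[normal_prob 0 1]_x f x.
Proof.
move=> mf f0.
have mo : measurable_fun setT (-%R : mR -> mR) by exact: oppr_measurable.
rewrite !ge0_integral_normal_prob//; last exact: measurableT_comp.
pose F x := f x * (normal_pdf 0 1 x)%:E.
have mF : measurable_fun setT F.
  by apply: emeasurable_funM => //; apply/measurable_EFinP; exact: measurable_normal_pdf.
have F0 x : 0 <= F x by rewrite mule_ge0// lee_fin normal_pdf_ge0.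
transitivity (\int[pushforward lebesgue_measure (-%R : mR -> mR)]_x F x).
  rewrite (ge0_integral_pushforward mo lebesgue_measure measurableT mF); last first.
    by move=> x _; exact: F0.
  apply: eq_integral => x _; rewrite [RHS]/=.
  by rewrite /F !normal_pdfE ?oner_neq0// /normal_fun !subr0 sqrrN.
by apply: eq_measure_integral => //= A mA _; exact: lebesgue_measure_oppr.
Qed.

Definition tuple_opp n (t : n.-tuple mR) : n.-tuple mR :=
  [tuple of map (-%R : R -> R) t].

Lemma measurable_tuple_opp n : measurable_fun setT (@tuple_opp n).
Proof.
apply/measurable_fun_tnthP => i.
rewrite (_ : _ \o _ = (-%R : mR -> mR) \o (fun t : n.-tuple mR => tnth t i)).
  apply: measurableT_comp; last exact: measurable_tnth.
  exact: oppr_measurable.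
by apply/funext => t /=; rewrite tnth_map.
Qed.

Lemma ge0_integral_product_normal_opp n (h : n.-tuple mR -> \bar R) :
  measurable_fun setT h -> (forall t, 0 <= h t) ->
  \int[product_law (fun=> normal_prob 0 1)]_t h (tuple_opp t) =
  \int[product_law (fun=> normal_prob 0 1)]_t h t.
Proof.
elim: n h => [|n IH] h mh h0.
  rewrite !integral_product_law0//; first by congr h; apply: val_inj.
  exact: (measurableT_comp mh (@measurable_tuple_opp 0)).
have mho := measurableT_comp mh (@measurable_tuple_opp n.+1).
rewrite (@ge0_integral_product_lawS _ _ (fun t => h (tuple_opp t)))//.
rewrite (ge0_integral_product_lawS (fun=> normal_prob 0 1) mh h0).
rewrite -[RHS]ge0_integral_normal_prob_oppr; last 2 first.
- exact: (measurable_integral_tuple_cons (fun=> normal_prob 0 1) mh h0).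
- by move=> x; exact: integral_ge0.
apply: eq_integral => x _.
rewrite -[RHS]IH//; last exact: (measurable_tuple_cons_snd _ mh).
by apply: eq_integral => t _ /=; congr h; apply: val_inj.
Qed.

(** Tensorization: with the first coordinates frozen, the induction hypothesis shows that the
    partial integrals satisfy the one-dimensional condition. *)
Lemma gaussian_prekopa_leindler_tuple n (u v : n.-tuple mR -> \bar R) :
  measurable_fun setT u -> measurable_fun setT v ->
  (forall t, 0 <= u t) -> (forall t, 0 <= v t) ->
  (forall s t, u s * v t <=
    (expR ((\sum_(i < n) (tnth s i - tnth t i) ^+ 2) / 4))%:E) ->
  (\int[product_law (fun=> normal_prob 0 1)]_t u t) *
  (\int[product_law (fun=> normal_prob 0 1)]_t v t) <= 1.
Proof.
elim: n u v => [|n IH] u v mu mv u0 v0 uv.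
  rewrite !integral_product_law0//; apply: le_trans (uv _ _) _.
  by rewrite big_ord0 mul0r expR0.
rewrite !ge0_integral_product_lawS//.
apply: gaussian_prekopa_leindler1.
- exact: (measurable_integral_tuple_cons (fun=> normal_prob 0 1) mu u0).
- exact: (measurable_integral_tuple_cons (fun=> normal_prob 0 1) mv v0).
- by move=> x; exact: integral_ge0.
- by move=> x; exact: integral_ge0.
move=> x y; set c := ((x - y) ^+ 2 / 4)%R.
have c0 : (0 < (expR (- c))%:E) by rewrite lte_fin expR_gt0.
have mux := measurable_tuple_cons_snd x mu.
have mvy := measurable_tuple_cons_snd y mv.
(* The factor [expR (- c)] absorbs the cost of the first coordinate. *)
have := IH (fun t => (expR (- c))%:E * u [tuple of x :: t])
  (fun t => v [tuple of y :: t]).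
rewrite ge0_integralZl//.
rewrite -muleA => H; rewrite -[(expR c)%:E]mul1e -lee_pdivrMr ?expR_gt0//.
rewrite muleC -expRN; apply: H => //.
- exact: emeasurable_funM.
- by move=> t; rewrite mule_ge0// ltW.
move=> s t; rewrite -muleA muleC -lee_pdivlMr ?expR_gt0// -expRN opprK -EFinM.
apply: le_trans (uv _ _) _; rewrite lee_fin -expRD ler_expR big_ord_recl/=.
rewrite mulrDl addrC !(tnth_nth 0%R)/= -/c lerD2r.
under eq_bigr do rewrite !tnthS.
by [].
Qed.

(* A bound on the chi-square divergence, in a form that passes to product
   measures by integrating out one coordinate at a time. *)
Definition l2_dominates d (T : measurableType d) (K : R)
    (P Q : probability T R) :=
  forall h : T -> \bar R, measurable_fun setT h -> (forall x, 0 <= h x) ->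
    (\int[P]_x h x) * (\int[P]_x h x) <= K%:E * \int[Q]_x (h x * h x).

(** The bound for the first coordinate is applied to the partial integrals, and the induction
    hypothesis inside it; the constants multiply. *)
Lemma l2_dominates_product n (P Q : 'I_n -> probability mR R) (K : 'I_n -> R) :
  (forall i, 0 <= K i)%R -> (forall i, l2_dominates (K i) (P i) (Q i)) ->
  l2_dominates (\prod_(i < n) K i) (product_law P) (product_law Q).
Proof.
elim: n P Q K => [|n IH] P Q K K0 PQ h mh h0.
  rewrite !integral_product_law0//; last exact: emeasurable_funM.
  by rewrite big_ord0 mul1e.
have mhh : measurable_fun setT (fun t => h t * h t) by exact: emeasurable_funM.
have hh0 t : 0 <= h t * h t by exact: mule_ge0.
rewrite !ge0_integral_product_lawS//.
have mP := measurable_integral_tuple_cons P mh h0.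
have mQ := measurable_integral_tuple_cons Q mhh hh0.
apply: (le_trans (PQ ord0 _ mP _)); first by move=> x; exact: integral_ge0.
rewrite big_ord_recl EFinM -muleA lee_wpmul2l ?lee_fin//.
rewrite -ge0_integralZl//; last 2 first.
- by move=> x _; exact: integral_ge0.
- by rewrite lee_fin prodr_ge0.
apply: ge0_le_integral => //.
- by move=> x _; apply: mule_ge0; exact: integral_ge0.
- exact: emeasurable_funM.
- exact: emeasurable_funM.
move=> x _; apply: IH => //; exact: (measurable_tuple_cons_snd _ mh).
Qed.

End product_law_theory.

(** * Chi-square comparison of normal laws with different means *)

Section normal_l2_dominates.
Context (R : realType).
Local Open Scope ereal_scope.
Local Notation mu := (@lebesgue_measure R).

(** Completing the square. Divided by the centred density, it shows that the squared density
    integrates to exp(m^2/s^2), which is one plus the chi-square divergence. *)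
Lemma normal_pdf_sqr (m s x : R) : s != 0%R ->
  (normal_pdf m s x ^+ 2 =
   expR (m ^+ 2 / s ^+ 2) * (normal_pdf 0 s x * normal_pdf (2 * m) s x))%R.
Proof.
move=> s0; rewrite !normal_pdfE// /normal_fun exprMn -expRM_natl.
rewrite [X in _ = (_ * X)%R]mulrACA [RHS]mulrCA -!expRD -expr2.
by congr (_ * expR _)%R; field.
Qed.

(** Recovers the Cauchy-Schwarz form from its linearized versions by choosing [t]; infinite values
    are treated apart. *)
Lemma mule_le_of_forall_gt0 (I J : \bar R) (K : R) : 0 <= I -> 0 <= J ->
  (0 < K)%R ->
  (forall t, (0 < t)%R -> 2%:E * I <= t%:E * J + (K / t)%:E) ->
  I * I <= K%:E * J.
Proof.
move=> I0 J0 K0 IJ; move: J0 IJ; case: J => [j j0 IJ|_ _|//]; last first.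
  by rewrite gt0_muley ?lte_fin// leey.
move: I0 IJ; case: I => [i i0 IJ|_ /(_ _ ltr01)|//]; last first.
  by rewrite gt0_muley.
rewrite -!EFinM lee_fin; have [->|i_neq0] := eqVneq i 0%R.
  by rewrite mulr0 mulr_ge0// ltW.
have {i_neq0}i0 : (0 < i)%R by rewrite lt_neqAle eq_sym i_neq0.
(* With this [t] the last term equals [i] and cancels half of the left side. *)
have := IJ (K / i)%R; rewrite divr_gt0// => /(_ isT).
rewrite -!EFinM -EFinD lee_fin invf_div [(K * (_ / _))%R]mulrCA divff ?gt_eqF// mulr1.
rewrite -lerBlDr (_ : 2 * i - i = i)%R; last by ring.
by rewrite mulrAC ler_pdivlMr.
Qed.

Lemma normal_prob_l2_dominates (m s : R) : s != 0%R ->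
  l2_dominates (expR (m ^+ 2 / s ^+ 2)) (normal_prob m s) (normal_prob 0 s).
Proof.
move=> s0 h mh h0; set K := expR _.
have K0 : (0 < K)%R by exact: expR_gt0.
pose p a : R -> R := normal_pdf a s.
have mp a : measurable_fun setT (fun x => (p a x)%:E).
  by apply/measurable_EFinP; exact: measurable_normal_pdf.
have p0 a x : (0 < p a x)%R.
  by rewrite /p normal_pdfE// mulr_gt0 ?expR_gt0// normal_peak_gt0.
have pe0 a x : 0 <= (p a x)%:E by rewrite lee_fin ltW.
have hh0 x : 0 <= h x * h x by exact: mule_ge0.
have mhh : measurable_fun setT (fun x => h x * h x) by exact: emeasurable_funM.
rewrite (ge0_integral_normal_prob m s mh h0).
rewrite (ge0_integral_normal_prob 0 s mhh hh0).
apply: mule_le_of_forall_gt0 => //.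
- by apply: integral_ge0 => x _; apply: mule_ge0 => //; exact: pe0.
- by apply: integral_ge0 => x _; apply: mule_ge0 => //; exact: pe0.
move=> t t0.
have mI1 : measurable_fun setT (fun x => h x * (p m x)%:E)
  by exact: (emeasurable_funM mh (mp m)).
have mI2 : measurable_fun setT (fun x => h x * h x * (p 0%R x)%:E)
  by exact: (emeasurable_funM mhh (mp 0%R)).
(* Writing the constant as an integral of the density of mean [2 * m] reduces the claim to a
   pointwise inequality. *)
have -> : (K / t)%:E = (K / t)%:E * \int[mu]_x (p (2 * m)%R x)%:E.
  by rewrite integral_normal_pdf mule1.
have Kt0 : (0 <= K / t)%R by rewrite divr_ge0// ltW.
have Z (c : R) (F : R -> \bar R) : (0 <= c)%R -> measurable_fun setT F ->
    (forall x, 0 <= F x) -> c%:E * \int[mu]_x F x = \int[mu]_x (c%:E * F x).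
  by move=> c0 mF F0; rewrite ge0_integralZl.
have mZ (c : R) (F : R -> \bar R) : measurable_fun setT F ->
    measurable_fun setT (fun x => c%:E * F x) by move=> mF; exact: emeasurable_funM.
have I10 x : 0 <= h x * (p m x)%:E by rewrite mule_ge0.
have I20 x : 0 <= h x * h x * (p 0%R x)%:E by rewrite mule_ge0.
rewrite (Z 2%R _ _ mI1)// (Z t _ (ltW t0) mI2)// (Z _ _ Kt0 (mp _))//.
have m2 := mZ t _ mI2; have m3 := mZ (K / t)%R _ (mp (2 * m)%R).
rewrite -ge0_integralD//; last 2 first.
- by move=> x _; rewrite mule_ge0// lee_fin ltW.
- by move=> x _; rewrite mule_ge0.
apply: ge0_le_integral => //.
- by move=> x _; rewrite mule_ge0.
- exact: (mZ 2%R _ mI1).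
- exact: emeasurable_funD.
move=> x _; have := h0 x; case: (h x) => [a a0| _|//]; last first.
  rewrite gt0_mulye ?lte_fin// gt0_mulye ?lte_fin// !gt0_muley ?lte_fin//.
rewrite -!EFinM -EFinD lee_fin -subr_ge0.
(* By [normal_pdf_sqr] the difference of the two sides is a perfect square over a positive
   number. *)
rewrite (_ : (_ - _ = (t * a * p 0 x - p m x) ^+ 2 / (t * p 0 x))%R).
  by rewrite divr_ge0 ?sqr_ge0// mulr_ge0// ltW.
have tn0 : t != 0%R by rewrite gt_eqF.
have pn0 : p 0%R x != 0%R by rewrite gt_eqF.
have -> : (K = p m x ^+ 2 / (p 0 x * p (2 * m) x))%R.
  by rewrite [(p m x ^+ 2)%R](normal_pdf_sqr m x s0) mulfK// gt_eqF// mulr_gt0//; exact: p0.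
by field; rewrite tn0 pn0 gt_eqF.
Qed.

End normal_l2_dominates.

(** * Euclidean structure *)

Section euclidean.
Context (R : realType) (d : nat).
Implicit Types x y z : 'rV[R]_d.

Lemma dotprodC x y : dotprod x y = dotprod y x.
Proof. by apply: eq_bigr => i _; rewrite mulrC. Qed.

Lemma dotprodDr x y z : dotprod x (y + z) = dotprod x y + dotprod x z.
Proof. by rewrite -big_split; apply: eq_bigr => i _; rewrite mxE mulrDr. Qed.

Lemma dotprodZr (a : R) x y : dotprod x (a *: y) = a * dotprod x y.
Proof. by rewrite mulr_sumr; apply: eq_bigr => i _; rewrite mxE mulrCA. Qed.

Lemma dotprodNr x y : dotprod x (- y) = - dotprod x y.
Proof. by rewrite -scaleN1r dotprodZr mulN1r. Qed.

Lemma dotprodBr x y z : dotprod x (y - z) = dotprod x y - dotprod x z.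
Proof. by rewrite dotprodDr dotprodNr. Qed.

Lemma dotprodDl x y z : dotprod (x + y) z = dotprod x z + dotprod y z.
Proof. by rewrite ![dotprod _ z]dotprodC dotprodDr. Qed.

Lemma dotprodZl (a : R) x y : dotprod (a *: x) y = a * dotprod x y.
Proof. by rewrite ![dotprod _ y]dotprodC dotprodZr. Qed.

Lemma dotprodNl x y : dotprod (- x) y = - dotprod x y.
Proof. by rewrite ![dotprod _ y]dotprodC dotprodNr. Qed.

Lemma dotprodBl x y z : dotprod (x - y) z = dotprod x z - dotprod y z.
Proof. by rewrite ![dotprod _ z]dotprodC dotprodBr. Qed.

Lemma dotprodxx_ge0 x : 0 <= dotprod x x.
Proof. by apply: sumr_ge0 => i _; rewrite -expr2 sqr_ge0. Qed.

Lemma l2norm_ge0 x : 0 <= l2norm x. Proof. exact: sqrtr_ge0. Qed.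

Lemma l2norm_sqr x : l2norm x ^+ 2 = dotprod x x.
Proof. by rewrite sqr_sqrtr// dotprodxx_ge0. Qed.

Lemma l2normN x : l2norm (- x) = l2norm x.
Proof. by rewrite /l2norm dotprodNl dotprodNr opprK. Qed.

Lemma l2normB x y : l2norm (x - y) = l2norm (y - x).
Proof. by rewrite -l2normN opprB. Qed.

Lemma l2normZ (a : R) x : l2norm (a *: x) = `|a| * l2norm x.
Proof.
by rewrite /l2norm dotprodZl dotprodZr mulrA -expr2 sqrtrM ?sqr_ge0// sqrtr_sqr.
Qed.

Lemma l2norm0 : l2norm (0 : 'rV[R]_d) = 0.
Proof. by rewrite -(scale0r 0) l2normZ normr0 mul0r. Qed.

Lemma dotprod_le x y : dotprod x y <= l2norm x * l2norm y.
Proof.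
(* For a vector of norm 0, expanding |y - t x|^2 bounds t<x,y> for every [t], so the product cannot
   be positive. *)
have [x0|x0] := eqVneq (l2norm x) 0.
  have H (t : R) : 2 * t * dotprod x y <= l2norm y ^+ 2.
    have := dotprodxx_ge0 (y - t *: x).
    rewrite dotprodBr !dotprodBl !dotprodZr !dotprodZl -!l2norm_sqr x0.
    by rewrite (dotprodC y x); nra.
  rewrite x0 mul0r leNgt; apply/negP => p0.
  have := H ((l2norm y ^+ 2 + 1) / dotprod x y).
  by rewrite mulrA mulfVK ?gt_eqF//; have := sqr_ge0 (l2norm y); nra.
have {}x0 : 0 < l2norm x by rewrite lt_neqAle eq_sym x0 l2norm_ge0.
have := dotprodxx_ge0 (l2norm x *: y - l2norm y *: x).
rewrite dotprodBr !dotprodBl !dotprodZr !dotprodZl -!l2norm_sqr (dotprodC y x) => H.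
have [y0|y0] := eqVneq (l2norm y) 0.
  have K (t : R) : 2 * t * dotprod x y <= l2norm x ^+ 2.
    have := dotprodxx_ge0 (x - t *: y).
    rewrite dotprodBr !dotprodBl !dotprodZr !dotprodZl -!l2norm_sqr y0.
    by rewrite (dotprodC y x); nra.
  rewrite y0 mulr0 leNgt; apply/negP => p0.
  have := K ((l2norm x ^+ 2 + 1) / dotprod x y).
  by rewrite mulrA mulfVK ?gt_eqF//; have := sqr_ge0 (l2norm x); nra.
have {}y0 : 0 < l2norm y by rewrite lt_neqAle eq_sym y0 l2norm_ge0.
have xy0 : 0 < l2norm x * l2norm y by rewrite mulr_gt0.
rewrite -(ler_pM2l xy0); nra.
Qed.

Lemma l2normD x y : l2norm (x + y) <= l2norm x + l2norm y.
Proof.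
rewrite -(@ler_pXn2r _ 2)// ?nnegrE ?addr_ge0 ?l2norm_ge0//.
rewrite l2norm_sqr dotprodDr !dotprodDl -!l2norm_sqr (dotprodC y x).
by have := dotprod_le x y; nra.
Qed.

Lemma l2norm_triangle x y z : l2norm (x - z) <= l2norm (x - y) + l2norm (y - z).
Proof. by rewrite (le_trans _ (l2normD _ _))// addrA subrK. Qed.

Lemma l2norm_le_sum x : l2norm x <= \sum_i `|x 0 i|.
Proof.
rewrite -(@ler_pXn2r _ 2)// ?nnegrE ?l2norm_ge0 ?sumr_ge0//.
rewrite l2norm_sqr expr2 mulr_suml; apply: ler_sum => i _.
rewrite (le_trans (ler_norm _))// normrM ler_wpM2l//.
by rewrite (bigD1 i)//= lerDl sumr_ge0.
Qed.

(** Stated without absolute value; exchanging [x] and [y] gives the two-sided bound. *)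
Definition l2_lipschitz (L : R) (F : 'rV[R]_d -> R) :=
  forall x y, F x - F y <= L * l2norm (x - y).

Lemma l2_lipschitz_measurable (L : R) (F : 'rV[R]_d -> R) :
  l2_lipschitz L F ->
  measurable_fun setT (F : borelRV R d -> measurableTypeR R).
Proof.
move=> FL; apply: (measurability _ (RGenOpens.measurableE R)).
move=> _ [_ [a [b ->] <-]]; rewrite setTI; apply: sub_sigma_algebra => /=.
rewrite openE => x /= Fx.
have /nbhs_ballP[e /= e0 eU] : nbhs (F x) `]a, b[%classic.
  by apply: open_nbhs_nbhs; split; [exact: interval_open|].
(* The topology is that of the sup norm, and the Euclidean norm is at most [d] times it; the summand
   1 keeps [c] positive. *)
pose c := `|L| * d%:R + 1.
have c0 : 0 < c by rewrite ltr_wpDl// mulr_ge0.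
apply/nbhs_ballP; exists (e / c) => /=; first by rewrite divr_gt0.
move=> y [_ xy] /=; apply: eU; rewrite /ball/=.
have bnd : `|L| * l2norm (x - y) < e.
  apply: (@le_lt_trans _ _ (`|L| * (d%:R * (e / c)))).
    rewrite ler_wpM2l// (le_trans (l2norm_le_sum _))//.
    rewrite mulr_natl -[d in leRHS]card_ord -sumr_const.
    by apply: ler_sum => i _; rewrite !mxE; apply: ltW; exact: xy.
  by rewrite !mulrA ltr_pdivrMr// [ltRHS]mulrC ltr_pM2r// /c ltrDl.
have := FL x y; have := FL y x; rewrite (l2normB y x) => F1 F2.
have L1 : L * l2norm (x - y) <= `|L| * l2norm (x - y).
  by rewrite ler_wpM2r ?l2norm_ge0// ler_norm.
by rewrite ltr_norml; apply/andP; split; lra.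
Qed.

End euclidean.

(** * The standard Gaussian measure *)

(** Jensen's inequality, by integrating the tangent line of the exponential at the mean. *)
Lemma le_expR_integral d (T : measurableType d) (R : realType)
    (P : probability T R) (X : T -> R) :
  P.-integrable setT (EFin \o X) ->
  ((expR (fine (\int[P]_x (X x)%:E)))%:E <= \int[P]_x (expR (X x))%:E)%E.
Proof.
move=> iX; set m := fine _.
have mX : measurable_fun setT X by apply/measurable_EFinP; case/integrableP: iX.
have mE : (\int[P]_x (X x)%:E = m%:E)%E.
  by rewrite fineK//; exact: integrable_fin_num.
have me : measurable_fun setT (fun x => (expR (X x))%:E).
  by apply/measurable_EFinP; exact: measurableT_comp.
have [oo|fin] := eqVneq (\int[P]_x (expR (X x))%:E)%E +oo%E.
  by rewrite oo leey.
have ie : P.-integrable setT (fun x => (expR (X x))%:E).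
  apply/integrableP; split => //.
  under eq_integral do rewrite gee0_abs ?lee_fin ?expR_ge0//.
  by rewrite ltey.
have icst (c : R) : P.-integrable setT (fun=> c%:E).
  by exact: finite_measure_integrable_cst.
have il : P.-integrable setT (fun x => (expR m * (1 - m))%:E + (expR m)%:E * (X x)%:E)%E.
  by apply: integrableD => //; exact: integrableZl.
rewrite (@le_trans _ _ (\int[P]_x ((expR m * (1 - m))%:E + (expR m)%:E * (X x)%:E))%E)//.
  rewrite integralD//; last exact: integrableZl.
  rewrite integralZl// mE integral_cst// [X in (_ * X + _)%E]probability_setT.
  rewrite mule1 -EFinM -EFinD.
  by rewrite lee_fin; nra.
apply: le_integral => // x _; rewrite -EFinM -EFinD lee_fin.
have -> : expR (X x) = expR m * expR (X x - m) by rewrite -expRD addrC subrK.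
rewrite -mulrDr ler_wpM2l ?expR_ge0// (le_trans _ (expR_ge1Dx _))//.
by rewrite -addrA (addrC (- m)).
Qed.

Lemma l2_dominates_probability d (T : measurableType d) (R : realType) (K : R)
    (P Q : probability T R) (A : set T) :
  l2_dominates K P Q -> measurable A -> (P A * P A <= K%:E * Q A)%E.
Proof.
move=> PQ mA.
have iE (S : probability T R) : (\int[S]_x (\1_A x)%:E = S A)%E.
  by rewrite integral_indic// setIT.
have -> : Q A = (\int[Q]_x ((\1_A x)%:E * (\1_A x)%:E))%E.
  rewrite -iE; apply: eq_integral => x _.
  by rewrite -EFinM indicE -natrM mulnb andbb.
rewrite -iE; apply: PQ; first exact/measurable_EFinP/measurable_indic.
by move=> x; rewrite lee_fin.
Qed.

Section gaussian_theory.
Context (R : realType) (d : nat).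
Local Notation gam := (gaussian (0 : 'rV[R]_d) 1).
Local Open Scope ereal_scope.

Lemma ge0_integral_gaussian (theta : 'rV[R]_d) (s : R) (h : borelRV R d -> \bar R) :
  measurable_fun setT h -> (forall x, 0 <= h x) ->
  \int[gaussian theta s]_x h x =
  \int[product_law (fun i => normal_prob (theta ord0 i) s)]_t h (row_of_tuple t).
Proof. by move=> mh h0; rewrite ge0_integral_distribution. Qed.

Lemma ge0_integral_gaussian01 (h : borelRV R d -> \bar R) :
  measurable_fun setT h -> (forall x, 0 <= h x) ->
  \int[gam]_x h x =
  \int[product_law (fun=> normal_prob 0 1)]_t h (row_of_tuple t).
Proof.
move=> mh h0; rewrite ge0_integral_gaussian; [|exact: mh|exact: h0].
pose P (m : 'I_d -> R) i : probability (measurableTypeR R) R := normal_prob (m i) 1.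
rewrite -/(P (fun i => (0%R : 'rV[R]_d) ord0 i)).
have -> : (fun i => (0%R : 'rV[R]_d) ord0 i) = (fun=> 0%R).
  by apply/funext => i; rewrite mxE.
reflexivity.
Qed.

Lemma gaussian_l2_dominates (theta : 'rV[R]_d) (s : R) : s != 0%R ->
  l2_dominates (expR (l2norm theta ^+ 2 / s ^+ 2))
    (gaussian theta s) (gaussian 0 s).
Proof.
move=> s0 h mh h0.
have mhr : measurable_fun setT (fun t => h (@row_of_tuple R d t)).
  by apply: (measurableT_comp mh); exact: measurable_row_of_tuple.
have mhh : measurable_fun setT (fun x => h x * h x) by exact: emeasurable_funM.
have hh0 x : 0 <= h x * h x by exact: mule_ge0.
rewrite (ge0_integral_gaussian theta s mh h0).
have -> := ge0_integral_gaussian 0%R s mhh hh0.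
have -> : (expR (l2norm theta ^+ 2 / s ^+ 2))%R =
    (\prod_(i < d) expR (theta ord0 i ^+ 2 / s ^+ 2))%R.
  rewrite -(big_morph expR (@expRD R) (@expR0 R)) l2norm_sqr -mulr_suml.
  by congr (expR (_ / _))%R; apply: eq_bigr => i _; rewrite expr2.
apply: (l2_dominates_product (P := fun i => normal_prob (theta ord0 i) s)
  (Q := fun i => normal_prob ((0%R : 'rV[R]_d) ord0 i) s)).
- move=> i; exact: expR_ge0.
- by move=> i; rewrite mxE; exact: normal_prob_l2_dominates.
- exact: mhr.
- by move=> t; exact: h0.
Qed.

Lemma gaussian_prekopa_leindler (u v : borelRV R d -> \bar R) :
  measurable_fun setT u -> measurable_fun setT v ->
  (forall x, 0 <= u x) -> (forall x, 0 <= v x) ->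
  (forall x y : 'rV[R]_d, u x * v y <= (expR (l2norm (x - y) ^+ 2 / 4))%:E) ->
  (\int[gam]_x u x) * (\int[gam]_x v x) <= 1.
Proof.
move=> mu mv u0 v0 uv.
rewrite (ge0_integral_gaussian01 mu u0) (ge0_integral_gaussian01 mv v0).
apply: gaussian_prekopa_leindler_tuple; [| |by move=> t; exact: u0|by move=> t; exact: v0|].
- by apply: (measurableT_comp mu); exact: measurable_row_of_tuple.
- by apply: (measurableT_comp mv); exact: measurable_row_of_tuple.
move=> s t; apply: le_trans (uv _ _) _; rewrite lee_fin ler_expR ler_wpM2r//.
by rewrite l2norm_sqr; apply: ler_sum => i _; rewrite !mxE -expr2.
Qed.

Lemma ge0_integral_gaussian_opp (h : borelRV R d -> \bar R) :
  measurable_fun setT h -> (forall x, 0 <= h x) ->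
  \int[gam]_x h (- (x : 'rV[R]_d))%R = \int[gam]_x h x.
Proof.
move=> mh h0.
have mhr : measurable_fun setT (fun t => h (@row_of_tuple R d t)).
  by apply: (measurableT_comp mh); exact: measurable_row_of_tuple.
have rowN t : row_of_tuple (tuple_opp t) = (- row_of_tuple t)%R :> 'rV[R]_d.
  by apply/rowP => i; rewrite !mxE tnth_map.
have mN : measurable_fun setT (fun x : borelRV R d => (- (x : 'rV[R]_d))%R : borelRV R d).
  apply: measurability; first by [].
  move=> _ [U oU <-]; rewrite setTI; apply: sub_sigma_algebra => /=.
  by move: U oU; apply/continuousP; exact: opp_continuous.
rewrite (ge0_integral_gaussian01 (measurableT_comp mh mN)); last first.
  by move=> x; exact: h0.
rewrite (ge0_integral_gaussian01 mh h0).
rewrite -(ge0_integral_product_normal_opp mhr); last by move=> t; exact: h0.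
by apply: eq_integral => t _; rewrite rowN.
Qed.

Lemma integral_gaussian_opp (h : borelRV R d -> \bar R) :
  measurable_fun setT h ->
  \int[gam]_x h (- (x : 'rV[R]_d))%R = \int[gam]_x h x.
Proof.
move=> mh; rewrite integralE [RHS]integralE; congr (_ - _).
  rewrite -(ge0_integral_gaussian_opp (measurable_funepos mh)); last first.
    by move=> x; exact: funepos_ge0.
  by apply: eq_integral => x _; rewrite !funeposE.
rewrite -(ge0_integral_gaussian_opp (measurable_funeneg mh)); last first.
  by move=> x; exact: funeneg_ge0.
by apply: eq_integral => x _; rewrite !funenegE.
Qed.

End gaussian_theory.

(** * Gaussian concentration *)

Section concentration.
Context (R : realType) (d : nat) (P : probability (borelRV R d) R).
Local Open Scope ereal_scope.
Hypothesis PL : forall u v : borelRV R d -> \bar R,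
  measurable_fun setT u -> measurable_fun setT v ->
  (forall x, 0 <= u x) -> (forall x, 0 <= v x) ->
  (forall x y : 'rV[R]_d, u x * v y <= (expR (l2norm (x - y) ^+ 2 / 4))%:E) ->
  (\int[P]_x u x) * (\int[P]_x v x) <= 1.

Variables (L : R) (F : 'rV[R]_d -> R).
Hypothesis FL : l2_lipschitz L F.

Let mF : measurable_fun setT (F : borelRV R d -> R).
Proof. exact: l2_lipschitz_measurable FL. Qed.

Let mexp (b : R) : measurable_fun setT
  (fun x : borelRV R d => (expR (b * F x))%:E).
Proof. by apply/measurable_EFinP/measurableT_comp => //; exact: measurable_funM. Qed.

Let exp_ge0 (b : R) (x : borelRV R d) : 0 <= (expR (b * F x))%:E.
Proof. by rewrite lee_fin expR_ge0. Qed.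

(** [PL] applies to e^(bF), damped by [c], and e^(-bF), because b(F x - F y) <= |b||L||x - y| <= |x
    - y|^2/4 + b^2 L^2. *)
Let mgf_mul (b : R) :
  (\int[P]_x (expR (b * F x))%:E) * (\int[P]_x (expR (- b * F x))%:E) <=
  (expR (b ^+ 2 * L ^+ 2))%:E.
Proof.
pose c := expR (- (b ^+ 2 * L ^+ 2)).
have c0 : (0 < c)%R by exact: expR_gt0.
have H := PL (u := fun x => c%:E * (expR (b * F x))%:E)
  (v := fun x => (expR (- b * F x))%:E).
have := H _ (mexp (- b)) _ (exp_ge0 (- b)) _.
rewrite ge0_integralZl//; last by rewrite lee_fin ltW.
rewrite -muleA muleC -lee_pdivlMr// -expRN opprK mul1e; apply.
- exact: emeasurable_funM.
- by move=> x; rewrite mule_ge0// lee_fin ltW.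
move=> x y; rewrite -!EFinM lee_fin -!expRD ler_expR.
set r := l2norm (x - y).
have r0 : (0 <= r)%R by exact: l2norm_ge0.
have Fxy := FL x y; have := FL y x; rewrite l2normB => Fyx.
rewrite -/r in Fxy Fyx.
have := sqr_ge0 (r / 2 - `|b| * `|L|)%R.
rewrite (_ : (r / 2 - `|b| * `|L|) ^+ 2 =
    r ^+ 2 / 4 - r * (`|b| * `|L|) + `|b| ^+ 2 * `|L| ^+ 2)%R; last by field.
rewrite !real_normK ?num_real//.
suff : (b * (F x - F y) <= r * (`|b| * `|L|))%R by lra.
rewrite (le_trans (ler_norm _))// normrM mulrCA ler_wpM2l//.
have Lr : (L * r <= r * `|L|)%R by rewrite mulrC ler_wpM2l// ler_norm.
by rewrite ler_norml; apply/andP; split; lra.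
Qed.

Let exp_gt0 (b : R) : 0 < \int[P]_x (expR (b * F x))%:E.
Proof.
rewrite lt_neqAle integral_ge0// andbT eq_sym; apply/negP => /eqP e0.
have := ae_eq_integral_abs P measurableT (mexp b).
under eq_integral do rewrite gee0_abs//.
move=> /proj1/(_ e0) [N [mN PN0 subN]].
have NT : N = setT.
  apply/seteqP; split=> // x _; apply: subN => /=.
  move=> /(_ Logic.I) [] /eqP; rewrite gt_eqF//; exact: expR_gt0.
have PN1 : P N = 1 by rewrite NT; exact: probability_setT.
by have /eqP := etrans (esym PN1) PN0; rewrite onee_eq0.
Qed.

(** An infinite moment times the positive opposite moment would violate the product bound. *)
Let exp_lty (b : R) : \int[P]_x (expR (b * F x))%:E < +oo.
Proof.
rewrite ltey; apply/eqP => oo.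
by have := mgf_mul b; rewrite oo gt0_mulye.
Qed.

Let integrable_exp (b : R) : P.-integrable setT (fun x => (expR (b * F x))%:E).
Proof.
apply/integrableP; split; first exact: mexp.
by under eq_integral do rewrite gee0_abs//; exact: exp_lty.
Qed.

(** Dominated by the exponential moments, since |F| <= e^F + e^(-F). *)
Lemma l2_lipschitz_integrable :
  P.-integrable setT (fun x : borelRV R d => (F x)%:E).
Proof.
pose g (x : borelRV R d) := (expR (1 * F x))%:E + (expR (-1 * F x))%:E.
have ig : P.-integrable setT g.
  by apply: integrableD => //; exact: integrable_exp.
apply: (le_integrable measurableT _ _ ig).
- exact/measurable_EFinP.
- move=> x _; rewrite /g -EFinD !abse_EFin lee_fin mul1r mulN1r.
  rewrite [leRHS]ger0_norm ?addr_ge0 ?expR_ge0//.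
  have := expR_ge1Dx (F x); have := expR_ge1Dx (- F x).
  have := expR_ge0 (F x); have := expR_ge0 (- F x).
  by rewrite ler_norml => *; apply/andP; split; lra.
Qed.

(** In the product bound, Jensen replaces the moment of -bF by the exponential of its mean. *)
Lemma l2_lipschitz_mgf (b : R) :
  \int[P]_x (expR (b * (F x - fine (\int[P]_x (F x)%:E))))%:E <=
  (expR (b ^+ 2 * L ^+ 2))%:E.
Proof.
set m := fine _.
have iF := l2_lipschitz_integrable.
have mE : \int[P]_x (F x)%:E = m%:E.
  by rewrite fineK//; exact: integrable_fin_num.
have J : (expR (- b * m))%:E <= \int[P]_x (expR (- b * F x))%:E.
  have ibF : P.-integrable setT (fun x => (- b * F x)%:E).
    by under eq_fun do rewrite EFinM; exact: integrableZl.
  have := le_expR_integral ibF.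
  under [X in fine X]eq_integral do rewrite EFinM.
  by rewrite integralZl// mE.
have -> : \int[P]_x (expR (b * (F x - m)))%:E =
    (expR (- b * m))%:E * \int[P]_x (expR (b * F x))%:E.
  rewrite -ge0_integralZl//.
  apply: eq_integral => x _; rewrite -EFinM -expRD.
  by congr (expR _)%:E; ring.
apply: le_trans (mgf_mul b); rewrite muleC lee_wpmul2l//.
exact: ltW (exp_gt0 b).
Qed.

End concentration.

(** * Support functions and Gaussian width *)

Section support_function.
Context (R : realType) (d : nat).
Implicit Types (S : set 'rV[R]_d) (x g : 'rV[R]_d).

Definition support_fun S g : R := sup [set dotprod x g | x in S].

Variables (S : set 'rV[R]_d) (L : R).
Hypotheses (S0 : S !=set0) (SL : S `<=` l2ball L).

Lemma support_fun_ub x g : S x -> dotprod x g <= support_fun S g.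
Proof.
move=> Sx; apply: ub_le_sup; last by exists x.
exists (L * l2norm g) => _ [y Sy <-].
by rewrite (le_trans (dotprod_le _ _))// ler_wpM2r ?l2norm_ge0//; exact: SL.
Qed.

Lemma support_fun_le g (c : R) :
  (forall x, S x -> dotprod x g <= c) -> support_fun S g <= c.
Proof.
move=> Sc; apply: ge_sup; last by move=> _ [x Sx <-]; exact: Sc.
by case: S0 => x Sx; exists (dotprod x g), x.
Qed.

(** A supremum of linear forms of norm at most [L]. *)
Lemma support_fun_lipschitz : l2_lipschitz L (support_fun S).
Proof.
move=> g h; rewrite lerBlDr; apply: support_fun_le => x Sx.
rewrite -[g](subrK h) dotprodDr lerD ?support_fun_ub//.
rewrite (le_trans (dotprod_le _ _))// addrK ler_wpM2r ?l2norm_ge0//; exact: SL.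
Qed.

(** Links the extended supremum inside [gaussian_width] to the real one, to which the Lipschitz
    arguments apply. *)
Lemma ereal_sup_support_fun g :
  ereal_sup [set (dotprod x g)%:E | x in S] = (support_fun S g)%:E.
Proof.
apply/eqP; rewrite eq_le; apply/andP; split.
  by apply: ge_ereal_sup => _ [x Sx <-]; rewrite lee_fin support_fun_ub.
apply/lee_addgt0Pr => e e0.
have [_ [x Sx <-] xe] : exists2 y, [set dotprod x g | x in S] y & support_fun S g - e < y.
  apply: sup_gt; last by rewrite ltrBlDr ltrDl.
  by case: S0 => x Sx; exists (dotprod x g), x.
apply: (@le_trans _ _ (dotprod x g + e)%:E); first by rewrite lee_fin; lra.
by rewrite EFinD leeD2r//; apply: ereal_sup_ubound; exists x.
Qed.

End support_function.

Section width.
Context (R : realType) (d : nat).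
Local Notation gam := (gaussian (0 : 'rV[R]_d) 1).
Implicit Types (S T : set 'rV[R]_d).

Definition width S : R := fine (\int[gam]_g (support_fun S g)%:E)%E.

Section bounded.
Variables (S : set 'rV[R]_d) (L : R).
Hypotheses (S0 : S !=set0) (SL : S `<=` l2ball L).

Lemma integrable_support_fun :
  gam.-integrable setT (fun g : borelRV R d => (support_fun S g)%:E).
Proof.
exact: (l2_lipschitz_integrable (@gaussian_prekopa_leindler R d)
  (support_fun_lipschitz S0 SL)).
Qed.

Lemma integral_support_fun :
  (\int[gam]_g (support_fun S g)%:E = (width S)%:E)%E.
Proof.
by rewrite fineK//; apply: integrable_fin_num => //; exact: integrable_support_fun.
Qed.

Lemma gaussian_width_fin : gaussian_width S = (width S)%:E.
Proof.
rewrite -integral_support_fun; apply: eq_integral => g _.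
exact: (ereal_sup_support_fun S0 SL g).
Qed.

Lemma support_fun_mgf (b : R) :
  (\int[gam]_g (expR (b * (support_fun S g - width S)))%:E <=
   (expR (b ^+ 2 * L ^+ 2))%:E)%E.
Proof.
exact: (l2_lipschitz_mgf (@gaussian_prekopa_leindler R d)
  (support_fun_lipschitz S0 SL)).
Qed.

Lemma measurable_support_fun :
  measurable_fun setT (support_fun S : borelRV R d -> R).
Proof. exact: l2_lipschitz_measurable (support_fun_lipschitz S0 SL). Qed.

End bounded.

End width.

(** * Widths of localized pieces and covering numbers *)

Section symmetric_convex.
Context (R : realType) (d : nat) (T : set 'rV[R]_d).
Local Notation gam := (gaussian (0 : 'rV[R]_d) 1).
Hypotheses (cT : convex_set T) (sT : T = [set - x | x in T]).

Lemma symmetric_oppr x : T x -> T (- x).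
Proof. by move=> Tx; rewrite sT; exists x. Qed.

Lemma convex_setP x y (t : R) : 0 <= t -> t <= 1 -> T x -> T y ->
  T (t *: x + (1 - t) *: y).
Proof.
move=> t0 t1 Tx Ty.
by have := cT (Itv01 t0 t1) (mem_set Tx) (mem_set Ty) => /set_mem.
Qed.

Lemma convex_set_half_sub x y : T x -> T y -> T (2^-1 *: (x - y)).
Proof.
move=> Tx Ty; have := @convex_setP x (- y) 2^-1.
rewrite (_ : 1 - 2^-1 = 2^-1 :> R); last by field.
by rewrite -scalerDr; apply => //; [lra|exact: symmetric_oppr].
Qed.

Lemma convex_set0 x : T x -> T 0.
Proof. by move=> Tx; have := convex_set_half_sub Tx Tx; rewrite subrr scaler0. Qed.

Lemma convex_setZ x (t : R) : 0 <= t -> t <= 1 -> T x -> T (t *: x).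
Proof.
move=> t0 t1 Tx; have := convex_setP t0 t1 Tx (convex_set0 Tx).
by rewrite scaler0 addr0.
Qed.

(* The point where convexity and central symmetry enter: the midpoints of a
   localized piece [C] and of its reflection lie in [T] near the origin, and
   [C] and its reflection have the same width. *)
Lemma width_local_le (C : set 'rV[R]_d) (c : 'rV[R]_d) (rho : R) :
  C !=set0 -> C `<=` T -> (forall x, C x -> l2norm (x - c) <= rho) ->
  width C <= width (T `&` l2ball rho).
Proof.
move=> [z Cz] CT Cc.
have C0 : C !=set0 by exists z.
pose L := l2norm c + rho.
have CL : C `<=` l2ball L.
  move=> x Cx; rewrite /l2ball/= /L; have := l2normD (x - c) c.
  by rewrite subrK; have := Cc x Cx; lra.
have rho0 : 0 <= rho by apply: le_trans (Cc _ Cz); exact: l2norm_ge0.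
set B := T `&` l2ball rho.
have B0 : B !=set0.
  by exists 0; split; [exact: convex_set0 (CT _ Cz)|rewrite /l2ball/= l2norm0].
have BL : B `<=` l2ball rho by move=> x [].
pose Z (g : 'rV[R]_d) := support_fun C g; pose W (g : 'rV[R]_d) := support_fun B g.
(* The left side is the supremum of <x - y, g> over pairs in [C], and half of x - y lies in [B]. *)
have ZW (g : 'rV[R]_d) : Z g + Z (- g) <= 2 * W g.
  suff : Z g <= 2 * W g - Z (- g) by lra.
  apply: (support_fun_le C0) => x Cx.
  suff : Z (- g) <= 2 * W g - dotprod x g by lra.
  apply: (support_fun_le C0) => y Cy.
  have Bxy : B (2^-1 *: (x - y)).
    split; first by apply: convex_set_half_sub; exact: CT.
    rewrite /l2ball/= l2normZ ger0_norm//.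
    have := l2norm_triangle x c y; have := Cc x Cx; have := Cc y Cy.
    by rewrite (l2normB y c); lra.
  have := support_fun_ub BL g Bxy.
  by rewrite dotprodZl dotprodBl dotprodNr -/(W g); lra.
have LZ := support_fun_lipschitz C0 CL.
have LZN : l2_lipschitz L (fun g => Z (- g)).
  by move=> g h; have := LZ (- g) (- h); rewrite -opprD l2normN.
have iZ := integrable_support_fun C0 CL.
have iW := integrable_support_fun B0 BL.
have iZN := l2_lipschitz_integrable (@gaussian_prekopa_leindler R d) LZN.
have mZ : measurable_fun setT (fun g : borelRV R d => (Z g)%:E).
  by case/integrableP: iZ.
(* By symmetry of the Gaussian law both summands on the left have mean [width C]. *)
have := le_integral measurableT (integrableD measurableT iZ iZN)
  (integrableZl measurableT 2 iW).
rewrite (integralD measurableT iZ iZN) (integralZl measurableT iW).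
rewrite (integral_support_fun B0 BL) (integral_gaussian_opp mZ).
rewrite (integral_support_fun C0 CL) -EFinM -EFinD lee_fin => H.
suff : width C + width C <= 2 * width B by lra.
by apply: H => g _; rewrite -EFinM -EFinD lee_fin; exact: ZW.
Qed.

(** Exponential union bound over the pieces around the net: each has width at most that of the ball
    of radius [rho], and concentration controls its moment. Jensen gives the left side. *)
Lemma width_net_le (r rho b : R) (s : seq 'rV[R]_d) :
  T !=set0 -> 0 <= r -> 0 < b ->
  (forall y, y \in s -> (T `&` l2ball r) y) ->
  (forall x, (T `&` l2ball r) x -> exists2 y, y \in s & l2norm (x - y) <= rho) ->
  expR (b * (width (T `&` l2ball r) - width (T `&` l2ball rho)))
    <= (size s)%:R * expR (b ^+ 2 * r ^+ 2).
Proof.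
move=> [z Tz] r0 b0 sS net; set S := T `&` l2ball r; set m := width (_ `&` l2ball rho).
have S0 : S !=set0.
  by exists 0; split; [exact: convex_set0 Tz|rewrite /l2ball/= l2norm0].
have SL : S `<=` l2ball r by move=> x [].
pose C y := S `&` [set x | l2norm (x - y) <= rho].
have rho0 : 0 <= rho.
  by case: S0 => x /net[y _]; apply: le_trans; exact: l2norm_ge0.
have C0 y : y \in s -> C y !=set0.
  by move=> ys; exists y; split; [exact: sS|rewrite /= subrr l2norm0].
have CL y : C y `<=` l2ball r by move=> x [[]].
pose e y (g : borelRV R d) : \bar R := (expR (b * (support_fun (C y) g - m)))%:E.
(* Off the net a piece may be empty, and its support function is then 0. *)
have mC y : measurable_fun setT (support_fun (C y) : borelRV R d -> R).
  have [Cy0|/nonemptyPn Cy0] := pselect (C y !=set0).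
    exact: measurable_support_fun Cy0 (@CL y).
  rewrite (_ : support_fun _ = cst 0)//; apply/funext => g.
  by rewrite /support_fun Cy0 image_set0 sup0.
have me y : measurable_fun setT (e y).
  apply/measurable_EFinP/measurableT_comp => //.
  by apply: measurable_funM => //; apply: measurable_funB.
have e0 y g : (0 <= e y g)%E by rewrite lee_fin expR_ge0.
have ie y : y \in s -> (\int[gam]_g e y g <= (expR (b ^+ 2 * r ^+ 2))%:E)%E.
  move=> ys; apply: le_trans (support_fun_mgf (C0 y ys) (@CL y) b).
  apply: ge0_le_integral.
  - exact: measurableT.
  - by move=> g _; exact: e0.
  - exact: me.
  - apply/measurable_EFinP/measurableT_comp => //.
    by apply: measurable_funM => //; apply: measurable_funB.
  move=> g _; rewrite lee_fin ler_expR (ler_pM2l b0) lerD2l lerN2.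
  by apply: (@width_local_le _ y) => [|x [[]]//|x []//]; exact: C0.
have pt (g : borelRV R d) : ((expR (b * (support_fun S g - m)))%:E <= \sum_(y <- s) e y g)%E.
  rewrite sumEFin lee_fin.
  set c := \sum_(_ <- _) _.
  have c_ub x : S x -> expR (b * (dotprod x g - m)) <= c.
    move=> Sx; have [y ys xy] := net _ Sx.
    rewrite /c (perm_big _ (perm_to_rem ys)) big_cons.
    rewrite (@le_trans _ _ (expR (b * (support_fun (C y) g - m))))//.
      rewrite ler_expR (ler_pM2l b0) lerD2r.
      by apply: (support_fun_ub (@CL y)); split.
    by rewrite lerDl sumr_ge0// => ? _; exact: expR_ge0.
  have c0 : 0 < c by case: S0 => x /c_ub; apply: lt_le_trans; exact: expR_gt0.
  (* After a logarithm the bound is linear in <x,g>, so it passes to the supremum. *)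
  rewrite -[c]lnK ?posrE// ler_expR mulrC -ler_pdivlMr// lerBlDr.
  apply: (support_fun_le S0) => x /c_ub.
  rewrite -[c]lnK ?posrE// ler_expR mulrC -ler_pdivlMr// lerBlDr.
  by rewrite lnK.
have iS : gam.-integrable setT (fun g : borelRV R d => (b * (support_fun S g - m))%:E).
  under eq_fun do rewrite EFinM EFinB.
  apply: integrableZl => //; apply: integrableB => //.
    exact: integrable_support_fun S0 SL.
  exact: finite_measure_integrable_cst.
have := le_expR_integral iS.
have -> : (\int[gam]_g (b * (support_fun S g - m))%:E = (b * (width S - m))%:E)%E.
  under eq_integral do rewrite EFinM EFinB.
  have icst : gam.-integrable setT (fun=> m%:E) by exact: finite_measure_integrable_cst.
  have iSf := integrable_support_fun S0 SL.
  rewrite (integralZl measurableT (integrableB measurableT iSf icst)).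
  rewrite (integralB measurableT iSf icst) (integral_support_fun S0 SL).
  by rewrite integral_cst// [X in (_ - _ * X)%E]probability_setT mule1.
move=> H; rewrite -lee_fin; apply: (le_trans H).
apply: (@le_trans _ _ (\int[gam]_g \sum_(y <- s) e y g)%E).
  apply: ge0_le_integral.
  - exact: measurableT.
  - by move=> g _; rewrite lee_fin expR_ge0.
  - apply/measurable_EFinP/measurableT_comp => //.
    by apply/measurable_EFinP; case/integrableP: iS.
  - by apply: emeasurable_sum => y; exact: me.
  - by move=> g _; exact: pt.
rewrite (ge0_integral_sum _ measurableT me); last by move=> y g _; exact: e0.
rewrite big_seq; apply: (le_trans (lee_sum _ ie)).
by rewrite -big_seq sumEFin lee_fin big_const_seq count_predT iter_addr_0 mulr_natl.
Qed.

End symmetric_convex.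

(** * Lower bounds on the minimax risk *)

Section testing.
Context d (U : measurableType d) (R : realType) (P : probability U R).

(** Markov's inequality, read on the complementary event. *)
Lemma markov_lt (h : U -> R) (c V : R) : 0 < c -> measurable_fun setT h ->
  (forall x, 0 <= h x) -> (\int[P]_x (h x)%:E <= V%:E)%E ->
  ((1 - V / c)%:E <= P [set x | (h x < c)%R])%E.
Proof.
move=> c0 mh h0 hV; set A := [set x | (h x < c)%R].
have mA : measurable A.
  have /(_ measurableT [set true]) := measurable_fun_ltr mh (measurable_cst c).
  by rewrite setTI; exact.
have mAC : measurable (~` A) by exact: measurableC.
have : (c%:E * P (~` A) <= V%:E)%E.
  apply: le_trans hV; rewrite -[~` A]setIT -integral_indic// -ge0_integralZl//; last 2 first.
  - exact/measurable_EFinP/measurable_indic.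
  - by rewrite lee_fin ltW.
  apply: ge0_le_integral => //.
  - by move=> x _; rewrite mule_ge0// lee_fin// ltW.
  - by apply: emeasurable_funM => //; exact/measurable_EFinP/measurable_indic.
  - exact/measurable_EFinP.
  move=> x _; rewrite -EFinM lee_fin indicE; have [|_] := boolP (x \in ~` A).
    by rewrite inE /= => /negP; rewrite -leNgt mulr1.
  by rewrite mulr0.
rewrite probability_setC//; have : P A \is a fin_num by exact: fin_num_measure.
case: (P A) => // p _; rewrite -EFinB -EFinM !lee_fin => pV.
by rewrite lerBlDr -lerBlDl ler_pdivlMr// mulrC.
Qed.

Lemma sum_probability_le1 n (A : 'I_n -> set U) :
  (forall i, measurable (A i)) -> (forall i j x, A i x -> A j x -> i = j) ->
  (\sum_(i < n) P (A i) <= 1)%E.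
Proof.
move=> mA tA; have tA' : trivIset setT A.
  by move=> i j _ _ [x [Ai Aj]]; exact: tA Ai Aj.
rewrite -measure_bigsetU_ord//.
by apply: probability_le1; exact: bigsetU_measurable.
Qed.

End testing.

Section packing.
Context (R : realType) (d : nat).
Implicit Types (x y : 'rV[R]_d) (s : seq 'rV[R]_d).

(** Greedy packing: a separated list that cannot be extended is a net, and the search stops at [n]
    points. *)
Lemma separated_or_net (A : set 'rV[R]_d) (delta : R) n :
  (exists s, [/\ size s = n, forall y, y \in s -> A y &
     pairwise (fun x y => delta < l2norm (x - y)) s]) \/
  (exists s, [/\ (size s < n)%N, forall y, y \in s -> A y &
     forall x, A x -> exists2 y, y \in s & l2norm (x - y) <= delta]).
Proof.
elim: n => [|n [[s [sn sA sd]]|[s [sn sA net]]]]; first by left; exists [::].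
  have [net|] := pselect (forall x, A x -> exists2 y, y \in s & l2norm (x - y) <= delta).
    by right; exists s; rewrite sn.
  move=> /existsNP[x /not_implyP[Ax xs]]; left; exists (x :: s); split=> /=.
  - by rewrite sn.
  - by move=> y; rewrite inE => /predU1P[->//|]; exact: sA.
  rewrite sd andbT; apply/allP => y ys; rewrite ltNge; apply/negP => xy.
  by apply: xs; exists y.
by right; exists s; split=> //; exact: ltnW.
Qed.

(** An estimator of small risk identifies each point of the list with high probability. Under the
    centred law the identification events are disjoint, and the chi-square bound makes each too
    likely for so many points. *)
Lemma packing_risk (est : borelRV R d -> borelRV R d) (sigma delta rad V : R) s :
  0 < sigma -> measurable_fun setT est -> 0 < delta ->
  (forall y, y \in s -> l2norm y <= rad) ->
  pairwise (fun x y => delta <= l2norm (x - y)) s ->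
  (1 < size s)%N -> expR (2 * (rad ^+ 2 / sigma ^+ 2)) <= (size s)%:R ->
  (forall y, y \in s ->
    (\int[gaussian y sigma]_z (l2norm ((est z : 'rV[R]_d) - y) ^+ 2)%:E <= V%:E)%E) ->
  delta ^+ 2 <= 40 * V.
Proof.
move=> sigma0 mest delta0 srad sd s1 sK sV; rewrite leNgt; apply/negP => Vd.
pose th (i : 'I_(size s)) := nth 0 s i.
have ths i : th i \in s by exact: mem_nth.
pose h y (z : borelRV R d) : R := l2norm ((est z : 'rV[R]_d) - y) ^+ 2.
have mh y : measurable_fun setT (h y).
  apply: measurable_funX.
  have := @l2_lipschitz_measurable R d 1 (fun z => l2norm (z - y)) => H.
  apply: (measurableT_comp (H _) mest) => z z'.
  rewrite mul1r; have := l2norm_triangle z z' y; lra.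
pose A i := [set z | h (th i) z < (delta / 2) ^+ 2].
have d20 : 0 < (delta / 2) ^+ 2 by rewrite exprn_gt0// divr_gt0.
have mA i : measurable (A i).
  have /(_ measurableT [set true]) :=
    measurable_fun_ltr (mh (th i)) (measurable_cst ((delta / 2) ^+ 2)).
  by rewrite setTI; exact.
have tA i j z : A i z -> A j z -> i = j.
  have wlog_lt (k l : 'I_(size s)) : (k < l)%N -> A k z -> A l z -> False.
    rewrite /A /h/= !ltr_pXn2r// ?nnegrE ?l2norm_ge0 ?divr_ge0 ?ltW// => kl kz lz.
    have /(pairwiseP 0)/(_ k l) := sd.
    rewrite !inE !ltn_ord => /(_ isT isT kl); rewrite -/(th k) -/(th l).
    have := l2norm_triangle (th k) (est z) (th l).
    by rewrite (l2normB (th k) (est z)); lra.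
  move=> Ai Aj; apply: val_inj; case: (ltngtP i j) => // ij.
    by case: (wlog_lt i j).
  by case: (wlog_lt j i).
set K := expR (rad ^+ 2 / sigma ^+ 2).
have rad0 : 0 <= rad.
  by have := srad _ (ths (Ordinal (ltnW s1))); apply: le_trans; exact: l2norm_ge0.
have PA i : ((81 / 100)%:E <= K%:E * gaussian (0 : 'rV[R]_d) sigma (A i))%E.
  (* By Markov the failure probability is at most 4V/delta^2, below 1/10 by the assumed bound on
     [V]. *)
  have PAi : ((9 / 10)%:E <= gaussian (th i) sigma (A i))%E.
    apply: le_trans (markov_lt d20 (mh (th i)) _ (sV _ (ths i))); last first.
      by move=> z; exact: sqr_ge0.
    rewrite lee_fin lerBrDr -lerBrDl ler_pdivrMr//.
    by move: Vd; rewrite expr_div_n; lra.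
  have dom := gaussian_l2_dominates (th i) (lt0r_neq0 sigma0).
  apply: (@le_trans _ _ (gaussian (th i) sigma (A i) * gaussian (th i) sigma (A i)))%E.
    apply: (@le_trans _ _ ((9 / 10)%:E * (9 / 10)%:E))%E.
      by rewrite -EFinM lee_fin; lra.
    by apply: lee_pmul => //; rewrite lee_fin; lra.
  apply: (le_trans (l2_dominates_probability dom (mA i))).
  apply: lee_wpmul2r; first exact: measure_ge0.
  rewrite lee_fin ler_expR ler_wpM2r ?invr_ge0 ?sqr_ge0//.
  by rewrite lerXn2r ?nnegrE ?l2norm_ge0// srad.
have : (\sum_(i < size s) (81 / 100)%:E <= K%:E * 1)%E.
  apply: (@le_trans _ _ (\sum_(i < size s) (K%:E * gaussian (0 : 'rV[R]_d) sigma (A i))))%E.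
    by apply: lee_sum => i _; exact: PA.
  rewrite -ge0_sume_distrr; last by move=> i _; exact: measure_ge0.
  apply: lee_wpmul2l; first by rewrite lee_fin expR_ge0.
  exact: sum_probability_le1.
rewrite mule1 sumEFin lee_fin sumr_const card_ord -mulr_natl => H.
have KM : K ^+ 2 <= (size s)%:R by rewrite -expRM_natl.
have M2 : (2 : R) <= (size s)%:R by rewrite ler_nat.
have K0 : 0 <= K by exact: expR_ge0.
move: M2 H KM; set M : R := (size s)%:R => M2 H KM.
(* Together with K^2 <= M this gives M (81/100)^2 <= 1, impossible for M >= 2. *)
have : (M * (81 / 100)) ^+ 2 <= K ^+ 2.
  by rewrite lerXn2r ?nnegrE//; lra.
by nra.
Qed.

End packing.

Section risk_lower_bounds.
Context (R : realType) (d : nat) (T : set 'rV[R]_d) (sigma V : R).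
Context (est : borelRV R d -> borelRV R d).
Hypotheses (cT : convex_set T) (sT : T = [set - x | x in T]).
Hypotheses (sigma0 : 0 < sigma) (mest : measurable_fun setT est).
Hypothesis risk_le : forall theta, T theta ->
  (\int[gaussian theta sigma]_y (l2norm ((est y : 'rV[R]_d) - theta) ^+ 2)%:E <= V%:E)%E.

(** A large increment rules out a small net at scale r/4, so there is a large separated set, to
    which the testing bound applies. *)
Lemma width_increment_risk (r : R) : T !=set0 -> 0 < r ->
  15 / 32 * (r ^+ 2 / sigma) <=
    width (T `&` l2ball r) - width (T `&` l2ball (r / 4)) ->
  r ^+ 2 <= 40 * 32 ^+ 2 * V.
Proof.
move=> T0 r0 incr; set x := r ^+ 2 / sigma ^+ 2.
have x0 : 0 < x by rewrite divr_gt0// exprn_gt0.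
(* The cardinality that [packing_risk] asks for at radius r/8; a list shorter than [M] has length at
   most [e]. *)
pose e := expR (x / 32); pose M := (Num.truncn e).+1.
have e1 : 1 < e by rewrite expR_gt1 divr_gt0.
have e0 : 0 <= e by rewrite expR_ge0.
have /andP[tr_le lt_tr] := truncn_itv e0.
have [[s [sM sS sd]]|[s [sM sS net]]] :=
  separated_or_net (T `&` l2ball r) (r / 4) M; last first.
  (* The maximizer of b (15/32) r^2/sigma - b^2 r^2; the contradiction is (15/64)^2 > 1/32. *)
  pose b := 15 / 64 / sigma.
  have b0 : 0 < b by rewrite divr_gt0.
  have := width_net_le cT sT T0 (ltW r0) b0 sS net.
  rewrite leNgt => /negP[].
  have se : (size s)%:R <= e by apply: le_trans tr_le; rewrite ler_nat.
  apply: (@le_lt_trans _ _ (e * expR (b ^+ 2 * r ^+ 2))).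
    by rewrite ler_wpM2r// expR_ge0.
  rewrite -expRD ltr_expR.
  apply: (@lt_le_trans _ _ (b * (15 / 32 * (r ^+ 2 / sigma)))); last by rewrite ler_pM2l.
  have -> : b * (15 / 32 * (r ^+ 2 / sigma)) = 2 * (15 / 64) ^+ 2 * x.
    by rewrite /b /x; field; rewrite gt_eqF.
  have -> : b ^+ 2 * r ^+ 2 = (15 / 64) ^+ 2 * x.
    by rewrite /b /x; field; rewrite gt_eqF.
  lra.
(* Shrinking by 8 keeps the points in [T] and brings the norms to r/8 and the separation to r/32. *)
have := @packing_risk R d est sigma (r / 32) (r / 8) V (map ( *:%R 8^-1) s) sigma0 mest.
rewrite divr_gt0// => /(_ isT) H.
suff : (r / 32) ^+ 2 <= 40 * V by rewrite expr_div_n; lra.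
apply: H.
- move=> _ /mapP[y /sS[_ yr] ->]; rewrite l2normZ ger0_norm// mulrC.
  by rewrite ler_wpM2r.
- rewrite pairwise_map; apply: sub_pairwise sd => y z /= yz.
  by rewrite -scalerBr l2normZ ger0_norm//; lra.
- rewrite size_map sM /M ltnS lt0n; apply/eqP => tr0.
  by move: lt_tr; rewrite tr0; lra.
- rewrite size_map sM; apply: le_trans (ltW lt_tr); rewrite ler_expR /x.
  by rewrite expr_div_n; lra.
move=> _ /mapP[y /sS[Ty _] ->]; apply: risk_le.
apply: (convex_setZ cT sT) => //; lra.
Qed.

(** Testing between two opposite multiples of [x]; it bounds |x|^2 when |x| <= sigma, and sigma^2
    otherwise. *)
Lemma two_point_risk (x : 'rV[R]_d) : T x ->
  Num.min (l2norm x) sigma ^+ 2 <= 40 * V.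
Proof.
move=> Tx; set t := Num.min _ _.
have [x0|x0] := eqVneq (l2norm x) 0.
  have V0 : 0 <= V.
    rewrite -lee_fin; apply: le_trans (risk_le Tx); apply: integral_ge0 => y _.
    by rewrite lee_fin sqr_ge0.
  rewrite /t x0 (_ : Num.min 0 sigma = 0); last by apply/min_idPl; exact: ltW.
  by rewrite expr0n/= mulr_ge0.
have {}x0 : 0 < l2norm x by rewrite lt_neqAle eq_sym x0 l2norm_ge0.
have t0 : 0 < t by rewrite lt_min x0.
have tx : t <= l2norm x by rewrite ge_min lexx.
have ts : t <= sigma by rewrite ge_min lexx orbT.
(* The test points then have norm t/2 and lie at distance [t]. *)
pose a := t / (2 * l2norm x).
have a0 : 0 <= a by rewrite divr_ge0 ?mulr_ge0// ltW.
have a1 : a <= 1 by rewrite ler_pdivrMr ?mulr_gt0// mul1r; lra.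
have ax : l2norm (a *: x) = t / 2.
  by rewrite l2normZ ger0_norm// /a; field; rewrite gt_eqF.
have Tax : T (a *: x) by exact: (convex_setZ cT sT).
apply: (@packing_risk R d est sigma t (t / 2) V [:: a *: x; - (a *: x)]) => //.
- by move=> y; rewrite !inE => /orP[] /eqP->; rewrite ?l2normN ax.
- rewrite /= !andbT opprK -[a *: x]scale1r -scalerDl l2normZ ax ger0_norm; lra.
(* Two points suffice since e^(1/2) <= 2. *)
- have hx : 2 * ((t / 2) ^+ 2 / sigma ^+ 2) <= 1 / 2.
    rewrite mulrA ler_pdivrMr ?exprn_gt0//.
    have : t ^+ 2 <= sigma ^+ 2 by rewrite ler_pXn2r// nnegrE ltW.
    by rewrite expr_div_n; lra.
  rewrite (@le_trans _ _ (expR (1 / 2)))// ?ler_expR//=.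
  have := expR_ge1Dx (- (1 / 2 : R)); rewrite expRN => h.
  have e0 : 0 < expR (1 / 2 : R) by exact: expR_gt0.
  have : expR (1 / 2 : R) * (expR (1 / 2))^-1 = 1 by rewrite divff// gt_eqF.
  by nra.
move=> y; rewrite !inE => /orP[] /eqP->; apply: risk_le => //.
exact: (symmetric_oppr sT).
Qed.

End risk_lower_bounds.

(** * The projection of Gaussian noise *)

(* The smaller integrand will be the projection, whose measurability is never
   established. *)
Lemma ge0_le_integral_sub d (U : measurableType d) (R : realType)
    (mu : {measure set U -> \bar R}) (f g : U -> \bar R) :
  (forall x, (0 <= f x)%E) -> (forall x, (f x <= g x)%E) ->
  (\int[mu]_x f x <= \int[mu]_x g x)%E.
Proof.
move=> f0 fg; have g0 x : (0 <= g x)%E by exact: le_trans (fg x).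
rewrite !ge0_integralTE//; apply: le_ereal_sup => _ [h hf <-].
by exists h => // x; exact: le_trans (fg x).
Qed.

(** Turns the exponential moments of concentration into a variance bound. *)
Lemma sqr_le_expR (R : realType) (x : R) : x ^+ 2 <= 4 * (expR x + expR (- x)).
Proof.
have pos (y : R) : 0 <= y -> y ^+ 2 <= 4 * expR y.
  move=> y0; have -> : expR y = expR (y / 2) ^+ 2.
    by rewrite -expRM_natl; congr expR; field.
  have := expR_ge1Dx (y / 2); nra.
have := expR_ge0 x; have := expR_ge0 (- x); have [x0|x0] := leP 0 x.
  by have := pos x x0; lra.
have nx0 : 0 <= - x by lra.
by have := pos _ nx0; rewrite sqrrN; lra.
Qed.

Section projection.
Context (R : realType) (d : nat) (T : set 'rV[R]_d).
Hypotheses (cT : convex_set T) (sT : T = [set - x | x in T]).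

(** If |p| > 4s, moving any point of norm at most [s] towards [p] until norm 4s gains enough in <.,
    g> to make [F] at least a multiple of s|p|/sigma. *)
Lemma l2norm_proj_le (g p : 'rV[R]_d) (sigma s : R) : 0 < sigma -> 0 < s ->
  T p -> (forall t, T t -> l2norm (sigma *: g - p) ^+ 2 <= l2norm (sigma *: g - t) ^+ 2) ->
  l2norm p ^+ 2 <= 16 * s ^+ 2 + 4 / 9 * (sigma ^+ 2 / s ^+ 2) *
    (support_fun (T `&` l2ball (4 * s)) g - support_fun (T `&` l2ball s) g) ^+ 2.
Proof.
move=> sigma0 s0 Tp pmin; set rho := l2norm p; set F := _ - _.
have [rs|sr] := leP rho (4 * s).
  rewrite (@le_trans _ _ (16 * s ^+ 2))//.
    have := l2norm_ge0 p; rewrite -/rho; nra.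
  by rewrite lerDl mulr_ge0 ?sqr_ge0// mulr_ge0// divr_ge0// sqr_ge0.
have S0 : (T `&` l2ball s) !=set0.
  by exists 0; split; [exact: (convex_set0 cT sT Tp)|rewrite /l2ball/= l2norm0 ltW].
have B4 : T `&` l2ball (4 * s) `<=` l2ball (4 * s) by move=> ? [].
(* Optimality of [p], with the squares expanded. *)
have var x : T x -> sigma * dotprod x g - l2norm x ^+ 2 / 2 <=
    sigma * dotprod p g - rho ^+ 2 / 2.
  move=> Tx; have := pmin _ Tx; rewrite /rho !l2norm_sqr !dotprodBr !dotprodBl.
  by rewrite !dotprodZr !dotprodZl (dotprodC g p) (dotprodC g x); lra.
have FE : 3 / 2 * (s * rho) <= sigma * F.
  suff : support_fun (T `&` l2ball s) g <=
      support_fun (T `&` l2ball (4 * s)) g - 3 / 2 * (s * rho) / sigma.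
    move=> H; rewrite -ler_pdivrMl// mulrC /F; lra.
  apply: (support_fun_le S0) => x [Tx xs].
  rewrite lerBrDr -lerBrDl ler_pdivrMr//.
  (* The weight for which lam rho + (1 - lam) s = 4s. *)
  pose lam := 3 * s / (rho - s).
  have rs0 : 0 < rho - s by lra.
  have lam0 : 0 <= lam by rewrite divr_ge0// ltW// mulr_gt0.
  have lam1 : lam <= 1 by rewrite ler_pdivrMr// mul1r; lra.
  have lamE : lam * (rho - s) = 3 * s by rewrite divfK// gt_eqF.
  have Tz := convex_setP cT lam0 lam1 Tp Tx.
  have zs : l2norm (lam *: p + (1 - lam) *: x) <= 4 * s.
    apply: (le_trans (l2normD _ _)); rewrite !l2normZ !ger0_norm ?subr_ge0//.
    have : (1 - lam) * l2norm x <= (1 - lam) * s by rewrite ler_wpM2l ?subr_ge0.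
    by rewrite -/rho; lra.
  have := support_fun_ub B4 g (conj Tz zs); rewrite dotprodDl !dotprodZl => H.
  have xx : l2norm x ^+ 2 <= s ^+ 2.
    by rewrite lerXn2r// ?nnegrE ?l2norm_ge0// ltW.
  have v := var x Tx.
  have h1 : lam * (sigma * dotprod x g + (rho ^+ 2 - s ^+ 2) / 2) <=
      lam * (sigma * dotprod p g) by rewrite ler_wpM2l//; lra.
  have h2 : lam * (rho ^+ 2 - s ^+ 2) = 3 * s * (rho + s) by rewrite -lamE; ring.
  have h3 := ler_wpM2l (ltW sigma0) H.
  have ss : 0 <= s ^+ 2 by exact: sqr_ge0.
  by lra.
have Fge : rho <= 2 / 3 * (sigma / s) * F.
  rewrite (_ : _ * F = sigma * F / (3 / 2 * s)); last by field; rewrite gt_eqF.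
  by rewrite ler_pdivlMr ?mulr_gt0//; lra.
have rho0 : 0 <= rho by exact: l2norm_ge0.
rewrite (_ : 4 / 9 * _ * _ = (2 / 3 * (sigma / s) * F) ^+ 2); last first.
  by field; rewrite gt_eqF.
rewrite (@le_trans _ _ ((2 / 3 * (sigma / s) * F) ^+ 2))//.
  by rewrite lerXn2r// nnegrE (le_trans rho0).
by rewrite lerDr mulr_ge0// sqr_ge0.
Qed.

End projection.

(** * Critical radius and projection moment against the risk of one estimator *)

Section least_squares_at_zero.
Context (R : realType) (d : nat) (T : set 'rV[R]_d) (sigma V : R).
Context (est : borelRV R d -> borelRV R d).
Local Notation gam := (gaussian (0 : 'rV[R]_d) 1).
Hypotheses (T0 : T !=set0) (cT : convex_set T) (sT : T = [set - x | x in T]).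
Hypotheses (sigma0 : 0 < sigma) (mest : measurable_fun setT est).
Hypothesis risk_le : forall theta, T theta ->
  (\int[gaussian theta sigma]_y (l2norm ((est y : 'rV[R]_d) - theta) ^+ 2)%:E <= V%:E)%E.

Let zeroT : T 0.
Proof. by have [x Tx] := T0; exact: (convex_set0 cT sT Tx). Qed.

Let ball_neq0 r : 0 <= r -> T `&` l2ball r !=set0.
Proof. by move=> r0; exists 0; split=> //; rewrite /l2ball/= l2norm0. Qed.

Let ball_sub r : T `&` l2ball r `<=` l2ball r. Proof. by move=> ? []. Qed.

Let V_ge0 : 0 <= V.
Proof.
rewrite -lee_fin; apply: le_trans (risk_le zeroT); apply: integral_ge0 => y _.
by rewrite lee_fin sqr_ge0.
Qed.

Lemma critical_radius_risk : critical_radius T sigma ^+ 2 <= 40 * 32 ^+ 2 * V.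
Proof.
(* Without a maximizer the default value is 0, and [V] is nonnegative. *)
rewrite /critical_radius; case: xgetP => [r _ [r0 rmax]|_]; last first.
  by rewrite expr0n/= mulr_ge0.
have {r0}[->|r0] : r = 0 \/ 0 < r.
- by move: r0; rewrite le_eqVlt => /predU1P[<-|]; [left|right].
- by rewrite expr0n/= mulr_ge0.
apply: (width_increment_risk cT sT sigma0 mest risk_le T0 r0).
have r40 : 0 < r / 4 by rewrite divr_gt0.
(* Maximality against r/4 gives the factor 15/32 = 1/2 - 1/32. *)
have := rmax (r / 4) (ltW r40).
rewrite (gaussian_width_fin (ball_neq0 (ltW r40)) (@ball_sub _)).
rewrite (gaussian_width_fin (ball_neq0 (ltW r0)) (@ball_sub _)).
rewrite -!EFinB lee_fin.
rewrite (_ : (r / 4) ^+ 2 / (2 * sigma) = 1 / 32 * (r ^+ 2 / sigma)); last first.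
  by field; rewrite gt_eqF.
rewrite (_ : r ^+ 2 / (2 * sigma) = 1 / 2 * (r ^+ 2 / sigma)); last first.
  by field; rewrite gt_eqF.
by lra.
Qed.

Lemma projection_moment_risk :
  (\int[gam]_g (l2norm (euclidean_proj T (sigma *: g)) ^+ 2)%:E <=
   ((66 + 178 * expR 1) * (40 * 32 ^+ 2 * V))%:E)%E.
Proof.
have e0 : 0 < expR 1 :> R by exact: expR_gt0.
pose S2 := 40 * 32 ^+ 2 * V.
have S20 : 0 <= S2 by rewrite mulr_ge0.
have V_S2 : 40 * V <= S2 by rewrite /S2; have := V_ge0; nra.
pose p (g : 'rV[R]_d) := euclidean_proj T (sigma *: g).
(* The default 0 lies in [T] as well. *)
have pT g : T (p g) by rewrite /p /euclidean_proj; case: xgetP => [q _ []|].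
(* If [T] lies in the ball of radius sigma, the two-point bound controls the projection pointwise;
   otherwise it bounds sigma^2. *)
have [small|/existsNP[x /not_implyP[Tx /negP]]] :=
    pselect (forall x, T x -> l2norm x <= sigma).
  apply: (@le_trans _ _ (\int[gam]_g (40 * V)%:E)%E).
    apply: ge0_le_integral_sub => g; rewrite lee_fin ?sqr_ge0//.
    have := two_point_risk cT sT sigma0 mest risk_le (pT g).
    by rewrite (min_idPl (small _ (pT g))).
  rewrite integral_cst// [X in (_ * X)%E]probability_setT mule1 lee_fin -/S2.
  by nra.
rewrite -ltNge => sx.
have sV : sigma ^+ 2 <= 40 * V.
  have := two_point_risk cT sT sigma0 mest risk_le Tx.
  by rewrite (min_idPr (ltW sx)).
have S2gt0 : 0 < S2 by apply: lt_le_trans V_S2; apply: lt_le_trans sV; rewrite exprn_gt0.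
pose s := Num.sqrt S2.
have s0 : 0 < s by rewrite sqrtr_gt0.
have s2 : s ^+ 2 = S2 by rewrite sqr_sqrtr// ltW.
have s40 : 0 < 4 * s by rewrite mulr_gt0.
have sig_s : sigma ^+ 2 / s ^+ 2 <= 1.
  by rewrite ler_pdivrMr ?exprn_gt0// mul1r s2 (le_trans sV).
pose D := width (T `&` l2ball (4 * s)) - width (T `&` l2ball s).
(* Otherwise the increment bound at radius 4s would give 16 s^2 <= s^2. *)
have incr : D < 15 / 2 * (s ^+ 2 / sigma).
  rewrite ltNge; apply/negP => incr.
  have := width_increment_risk cT sT sigma0 mest risk_le T0 s40.
  rewrite -/S2 (_ : 4 * s / 4 = s); last by field.
  rewrite (_ : 15 / 32 * ((4 * s) ^+ 2 / sigma) = 15 / 2 * (s ^+ 2 / sigma)); last first.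
    by field; rewrite gt_eqF.
  by move=> /(_ incr); rewrite exprMn s2; lra.
have B0 := ball_neq0 (ltW s0); have B40 := ball_neq0 (ltW s40).
have BL := @ball_sub s; have BL4 := @ball_sub (4 * s).
pose F (g : 'rV[R]_d) :=
  support_fun (T `&` l2ball (4 * s)) g - support_fun (T `&` l2ball s) g.
have LF : l2_lipschitz (5 * s) F.
  move=> g h; have := support_fun_lipschitz B40 BL4 g h.
  by have := support_fun_lipschitz B0 BL h g; rewrite (l2normB h g) /F; lra.
have FD : (\int[gam]_g (F g)%:E = D%:E)%E.
  under eq_integral do rewrite EFinB.
  rewrite (integralB measurableT (integrable_support_fun B40 BL4)
    (integrable_support_fun B0 BL)).
  by rewrite (integral_support_fun B40 BL4) (integral_support_fun B0 BL).
have D0 : 0 <= D.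
  rewrite -lee_fin -FD; apply: integral_ge0 => g _; rewrite lee_fin subr_ge0.
  apply: (support_fun_le B0) => y [Ty ys]; apply: (support_fun_ub BL4).
  by split=> //; apply: (le_trans ys); lra.
have D2 : sigma ^+ 2 / s ^+ 2 * D ^+ 2 <= 225 / 4 * s ^+ 2.
  rewrite (@le_trans _ _ (sigma ^+ 2 / s ^+ 2 * (15 / 2 * (s ^+ 2 / sigma)) ^+ 2))//.
    rewrite ler_wpM2l ?divr_ge0 ?sqr_ge0// lerXn2r// ?nnegrE ?(ltW incr)//.
    exact: le_trans D0 (ltW incr).
  by rewrite le_eqVlt; apply/orP; left; apply/eqP; field; rewrite !gt_eqF.
(* The inverse Lipschitz constant of [F], so that both exponential moments are at most e. *)
pose b := (5 * s)^-1.
have mgf (c : R) : c ^+ 2 = b ^+ 2 ->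
    (\int[gam]_g (expR (c * (F g - D)))%:E <= (expR 1)%:E)%E.
  move=> cb; have := l2_lipschitz_mgf (@gaussian_prekopa_leindler R d) LF c.
  rewrite FD /= => /le_trans; apply; rewrite lee_fin ler_expR cb /b -exprMn.
  by rewrite mulVf ?gt_eqF ?mulr_gt0// expr1n.
have mF : measurable_fun setT (F : borelRV R d -> R) by exact: l2_lipschitz_measurable LF.
have mE (c : R) : measurable_fun setT (fun g : borelRV R d => (expR (c * (F g - D)))%:E).
  apply/measurable_EFinP/measurableT_comp => //.
  by apply: measurable_funM => //; exact: measurable_funB.
(* Splitting F^2 <= 2 D^2 + 2 (F - D)^2 gives 16 + (4/9)(225/2) = 66 and (4/9) 200 <= 89. *)
have bound g : l2norm (p g) ^+ 2 <= 66 * s ^+ 2 +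
    89 * s ^+ 2 * (expR (b * (F g - D)) + expR (- b * (F g - D))).
  have E0 : 0 <= expR (b * (F g - D)) + expR (- b * (F g - D)).
    by rewrite addr_ge0 ?expR_ge0.
  have s20 : 0 <= s ^+ 2 by exact: sqr_ge0.
  rewrite /p /euclidean_proj; case: xgetP => [q _ [Tq qmin]|_]; last first.
    by have := mulr_ge0 s20 E0; rewrite l2norm0 expr0n/= -mulrA; lra.
  apply: (le_trans (l2norm_proj_le cT sT sigma0 s0 Tq qmin)); rewrite -/(F g).
  set k := sigma ^+ 2 / s ^+ 2 in sig_s D2 *.
  have k0 : 0 <= k by rewrite divr_ge0 ?sqr_ge0.
  have h1 : k * F g ^+ 2 <= 2 * (k * D ^+ 2) + 2 * (k * (F g - D) ^+ 2).
    rewrite !(mulrCA 2) -mulrDr ler_wpM2l//; have := sqr_ge0 (F g - 2 * D); nra.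
  have h2 : k * (F g - D) ^+ 2 <= (F g - D) ^+ 2 by rewrite ler_piMl// sqr_ge0.
  have h3 : (F g - D) ^+ 2 <=
      100 * (s ^+ 2 * (expR (b * (F g - D)) + expR (- b * (F g - D)))).
    have := sqr_le_expR (b * (F g - D)); rewrite -mulNr => h.
    rewrite (_ : (F g - D) ^+ 2 = 25 * s ^+ 2 * (b * (F g - D)) ^+ 2); last first.
      by rewrite /b; field; rewrite gt_eqF.
    have s25 : 0 <= 25 * s ^+ 2 by rewrite mulr_ge0.
    by have := ler_wpM2l s25 h; lra.
  have h4 : 0 <= s ^+ 2 * (expR (b * (F g - D)) + expR (- b * (F g - D))).
    by rewrite mulr_ge0.
  by rewrite -[4 / 9 * k * _]mulrA; lra.
have s66 : 0 <= 66 * s ^+ 2 by rewrite mulr_ge0 ?sqr_ge0.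
have s89 : 0 <= 89 * s ^+ 2 by rewrite mulr_ge0 ?sqr_ge0.
apply: (@le_trans _ _ (\int[gam]_g ((66 * s ^+ 2)%:E + (89 * s ^+ 2)%:E *
    ((expR (b * (F g - D)))%:E + (expR (- b * (F g - D)))%:E)))%E).
  apply: ge0_le_integral_sub => g; first by rewrite lee_fin sqr_ge0.
  by rewrite -EFinD lee_fin; exact: bound.
have mEE : measurable_fun setT (fun g : borelRV R d =>
    ((expR (b * (F g - D)))%:E + (expR (- b * (F g - D)))%:E)%E).
  exact: emeasurable_funD.
have EE0 (g : borelRV R d) :
    (0 <= (expR (b * (F g - D)))%:E + (expR (- b * (F g - D)))%:E)%E.
  by rewrite -EFinD lee_fin addr_ge0 ?expR_ge0.
rewrite ge0_integralD; last 5 first.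
- exact: measurableT.
- by move=> g _; rewrite lee_fin.
- exact: measurable_cst.
- by move=> g _; rewrite mule_ge0 ?lee_fin.
- by apply: emeasurable_funM => //; exact: measurable_cst.
rewrite ge0_integralZl; last 4 first.
- exact: measurableT.
- exact: mEE.
- by move=> g _; exact: EE0.
- by rewrite lee_fin.
rewrite ge0_integralD; last 5 first.
- exact: measurableT.
- by move=> g _; rewrite lee_fin expR_ge0.
- exact: mE.
- by move=> g _; rewrite lee_fin expR_ge0.
- exact: mE.
rewrite integral_cst// [X in (_ * X + _)%E]probability_setT mule1.
apply: (@le_trans _ _ ((66 * s ^+ 2)%:E + (89 * s ^+ 2)%:E * ((expR 1)%:E + (expR 1)%:E))%E).
  apply: leeD => //; apply: lee_wpmul2l; first by rewrite lee_fin.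
  by apply: leeD; apply: mgf; rewrite ?sqrrN.
rewrite -[X in (_ * X)%E]EFinD -EFinM -EFinD lee_fin s2 -/S2; lra.
Qed.

End least_squares_at_zero.

(** * Passage from a single estimator to the minimax rate *)

Theorem theorem5p1 (R : realType) :
  exists C : R, 0 < C /\
  forall (d : nat) (T : set 'rV[R]_d) (sigma : R),
    (0 < d)%N ->
    T !=set0 -> compact T -> convex_set T -> T = [set - x | x in T] ->
    0 < sigma ->
    (maxe (critical_radius T sigma ^+ 2)%:E
          (\int[gaussian (0 : 'rV[R]_d) 1]_g
             (l2norm (euclidean_proj T (sigma *: g)) ^+ 2)%:E)
     <= C%:E * minimax_rate T sigma ^+ 2)%E.
Proof.
pose K : R := 66 + 178 * expR 1.
have K1 : 1 <= K by have := expR_gt0 (1 : R); rewrite /K; lra.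
have K0 : 0 < K by lra.
pose C := K * (40 * 32 ^+ 2); have C0 : 0 < C by rewrite !mulr_gt0.
exists C; split=> // d T sigma _ T0 _ cT sT sigma0.
have risk0 theta (est : borelRV R d -> borelRV R d) :
    (0 <= \int[gaussian theta sigma]_y (l2norm ((est y : 'rV[R]_d) - theta) ^+ 2)%:E)%E.
  by apply: integral_ge0 => y _; rewrite lee_fin sqr_ge0.
have sup0 (est : borelRV R d -> borelRV R d) : (0 <= ereal_sup
    [set (\int[gaussian theta sigma]_y (l2norm ((est y : 'rV[R]_d) - theta) ^+ 2)%:E)%E
    | theta in T])%E.
  by have [x Tx] := T0; apply: le_trans (risk0 x est) _; apply: ereal_sup_ubound; exists x.
(* Squaring undoes [sqrte] because every worst-case risk is nonnegative. *)
rewrite sqr_sqrte; last by apply: le_ereal_inf_tmp => _ [est _ <-]; exact: sup0.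
(* With [C] on the left, the bound on the infimum is checked estimator by estimator. *)
rewrite muleC -lee_pdivrMr//.
apply: le_ereal_inf_tmp => _ [est /= mest <-].
rewrite lee_pdivrMr// muleC.
have := sup0 est.
set rho := ereal_sup _; have risk theta : T theta ->
    (\int[gaussian theta sigma]_y (l2norm ((est y : 'rV[R]_d) - theta) ^+ 2)%:E <= rho)%E.
  by move=> Tt; apply: ereal_sup_ubound; exists theta.
(* A finite worst-case risk serves as [V]; for an infinite one the bound is trivial. *)
case: rho risk => [V| |] risk V0; last by rewrite leeNy_eq in V0.
  rewrite -EFinM ge_max; apply/andP; split.
    rewrite lee_fin (le_trans (critical_radius_risk T0 cT sT sigma0 mest risk))//.
    rewrite /C -[K * _ * V]mulrA ler_peMl// mulr_ge0//; exact: V0.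
  apply: (le_trans (projection_moment_risk T0 cT sT sigma0 mest risk)).
  by rewrite lee_fin /C /K mulrA.
by rewrite gt0_muley ?lte_fin// leey.
Qed.
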